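(* Let $\mathbf{L}\in Q(\mathbb{B}^n)$. An analytic function $F:\mathbb{B}^n\to\mathbb{C}$ has bounded $\mathbf{L}$-index in joint variables if and only if there exist $p\in\mathbb{Z}_+$ and $c\in\mathbb{R}_+$ such that for each $z\in\mathbb{B}^n$ $$\max\left\{\frac{|F^{(J)}(z)|}{\mathbf{L}^J(z)}:\ J\in\mathbb{Z}^n_+,\ \|J\|=p+1\right\}\le c\cdot\max\left\{\frac{|F^{(K)}(z)|}{\mathbf{L}^K(z)}:\ K\in\mathbb{Z}^n_+,\ \|K\|\le p\right\}.$$
   Context: $\mathbb{R}_+=[0,\infty)$, $\mathbb{Z}_+=\{0,1,2,\dots\}$. $|\cdot|$ is the Euclidean norm on $\mathbb{C}^n$ (and on $\mathbb{R}^n$); $\mathbb{B}^n=\{z\in\mathbb{C}^n:|z|<1\}$. For $K\in\mathbb{Z}^n_+$: $\|K\|=k_1+\dots+k_n$, $K!=k_1!\cdots k_n!$, $A^K=a_1^{k_1}\cdots a_n^{k_n}$, and $F^{(K)}=\partial^{\|K\|}F/\partial z_1^{k_1}\cdots\partial z_n^{k_n}$. Quotients $A/B$ of vectors are componentwise. $\mathbb{D}^n[z^0,R]=\{z:|z_j-z^0_j|\le r_j,\ j=1,\dots,n\}$ for $R=(r_1,\dots,r_n)\in\mathbb{R}^n_+$. Fix a constant $\beta>\sqrt n$. Throughout, $\mathbf{L}(z)=(l_1(z),\dots,l_n(z))$, where each $l_j:\mathbb{B}^n\to\mathbb{R}_+$ is continuous and $l_j(z)>\beta/(1-|z|)$ for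 all $z\in\mathbb{B}^n$. (Then $\mathbb{D}^n[z^0,R/\mathbf{L}(z^0)]\subset\mathbb{B}^n$ whenever $z^0\in\mathbb{B}^n$, $|R|\le\beta$.) $Q(\mathbb{B}^n)$ is the class of such $\mathbf{L}$ satisfying, for all $R\in\mathbb{R}^n_+$ with $|R|\le\beta$ and all $j$, $0<\lambda_{1,j}(R)\le\lambda_{2,j}(R)<\infty$, where $\lambda_{1,j}(R)$ and $\lambda_{2,j}(R)$ are respectively the infimum and the supremum of $l_j(z)/l_j(z^0)$ over all $z^0\in\mathbb{B}^n$ and $z\in\mathbb{D}^n[z^0,R/\mathbf{L}(z^0)]$. An analytic $F:\mathbb{B}^n\to\mathbb{C}$ is of bounded $\mathbf{L}$-index in joint variables if there is $m\in\mathbb{Z}_+$ such that for all $z\in\mathbb{B}^n$ and $J\in\mathbb{Z}^n_+$: $\frac{|F^{(J)}(z)|}{J!\mathbf{L}^J(z)}\le\max\{\frac{|F^{(K)}(z)|}{K!\mathbf{L}^K(z)}:K\in\mathbb{Z}^n_+,\|K\|\le m\}$. *)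

(* Defs.v *)
From HB Require Import structures.
From mathcomp Require Import all_boot all_order all_algebra.
From mathcomp Require Import all_classical all_reals all_analysis.
From mathcomp Require Import complex.

Set Implicit Arguments.
Unset Strict Implicit.
Unset Printing Implicit Defensive.

Import Order.TTheory GRing.Theory Num.Theory.
Import numFieldNormedType.Exports.

Local Open Scope classical_set_scope.
Local Open Scope ring_scope.

(* Naming the structure, rather than using the bare type [R[i]], lets
   MathComp-Analysis put the topology and the normed module structure of a
   numeric field over itself on the complex numbers. *)
Definition Cplx (R : realType) : numClosedFieldType := R[i].

(* The library norm [`|z|] of a complex number is itself a complex number;
   [normc] is the same modulus with values in [R]. *)
Definition modulus (R : realType) (z : Cplx R) : R :=
  ComplexField.Normc.normc z.

Definition enorm (R : realType) (n : nat) (r : 'I_n -> R) : R :=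
  Num.sqrt (\sum_j r j ^+ 2).

Definition cenorm (R : realType) (n : nat) (z : 'rV[Cplx R]_n) : R :=
  enorm (fun j => modulus (z ord0 j)).

Definition unit_ball (R : realType) (n : nat) : set 'rV[Cplx R]_n :=
  [set z | cenorm z < 1].
Arguments unit_ball : clear implicits.

Definition polydisc (R : realType) (n : nat) (z0 : 'rV[Cplx R]_n)
    (r : 'I_n -> R) : set 'rV[Cplx R]_n :=
  [set z | forall j, modulus (z ord0 j - z0 ord0 j) <= r j].

Definition mindex (n : nat) := {ffun 'I_n -> nat}.

Definition mdeg (n : nat) (K : mindex n) : nat := (\sum_j K j)%N.

Definition mfact (n : nat) (K : mindex n) : nat := (\prod_j (K j)`!)%N.

Definition mpow (S : comNzRingType) (n : nat) (a : 'I_n -> S) (K : mindex n)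
    : S :=
  \prod_j a j ^+ K j.

(* Multi-indices with all entries [< N] form a finite type. The multi-indices
   of degree at most [m] are thus those of [{ffun 'I_n -> 'I_m.+1}] that
   satisfy the degree condition. *)
Definition mval (n N : nat) (K : {ffun 'I_n -> 'I_N}) : mindex n :=
  [ffun j => K j : nat].

Definition partial (R : realType) (n : nat) (j : 'I_n)
    (F : 'rV[Cplx R]_n -> Cplx R) : 'rV[Cplx R]_n -> Cplx R :=
  fun z => 'D_(delta_mx ord0 j) F z.

(* The first coordinate is outermost, as in
   d^|K| F / (dz_1^k_1 ... dz_n^k_n). *)
Definition mderiv (R : realType) (n : nat) (K : mindex n)
    (F : 'rV[Cplx R]_n -> Cplx R) : 'rV[Cplx R]_n -> Cplx R :=
  foldr (fun j G => iter (K j) (partial j) G) F (enum 'I_n).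

(* [F] is, on some polydisc around each point of [D], the sum of an absolutely
   convergent power series; by absolute convergence the choice of cubic partial
   sums is immaterial. For open [D] this only involves the values of [F]
   on [D]. *)
Definition analytic_on (R : realType) (n : nat) (D : set 'rV[Cplx R]_n)
    (F : 'rV[Cplx R]_n -> Cplx R) : Prop :=
  forall z0, D z0 ->
  exists (e : R) (a : mindex n -> Cplx R), 0 < e /\
    forall z : 'rV[Cplx R]_n,
    (forall j, modulus (z ord0 j - z0 ord0 j) < e) ->
    let term K := a K * mpow (fun j => z ord0 j - z0 ord0 j) K in
    summable [set: mindex n] (fun K => (modulus (term K))%:E) /\
    (fun N => \sum_(K : {ffun 'I_n -> 'I_N}) term (mval K)) @ \oo --> F z.

Section LIndex.
Variables (R : realType) (n : nat).
Implicit Types (L : 'I_n -> 'rV[Cplx R]_n -> R) (F : 'rV[Cplx R]_n -> Cplx R)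
  (r : 'I_n -> R) (z : 'rV[Cplx R]_n).

Definition lratios L r (j : 'I_n) : set \bar R :=
  [set x | exists z0 z, [/\ unit_ball R n z0,
     polydisc z0 (fun i => r i / L i z0) z & x = (L j z / L j z0)%:E]].

Definition lambda1 L r j : \bar R := ereal_inf (lratios L r j).

Definition lambda2 L r j : \bar R := ereal_sup (lratios L r j).

Definition classQ (beta : R) L : Prop :=
  [/\ forall j, {within unit_ball R n, continuous (L j)},
      forall j z, unit_ball R n z -> 0 <= L j z,
      forall j z, unit_ball R n z -> beta / (1 - cenorm z) < L j z
    & forall r, (forall j, 0 <= r j) -> enorm r <= beta ->
        forall j, [/\ (0 < lambda1 L r j)%E,
                      (lambda1 L r j <= lambda2 L r j)%E
                    & (lambda2 L r j < +oo)%E]].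

Definition dquot L F z (K : mindex n) : R :=
  modulus (mderiv K F z) / mpow (fun j => L j z) K.

(* In the maxima below all the values are nonnegative, so that the initial
   value 0 of the iterated maximum is harmless. *)
Definition bounded_Lindex L F : Prop :=
  exists m : nat, forall z, unit_ball R n z -> forall J : mindex n,
    modulus (mderiv J F z) / ((mfact J)%:R * mpow (fun j => L j z) J) <=
    \big[Num.max/0]_(K : {ffun 'I_n -> 'I_m.+1} | (mdeg (mval K) <= m)%N)
      (modulus (mderiv (mval K) F z) /
        ((mfact (mval K))%:R * mpow (fun j => L j z) (mval K))).

Definition max_dquot_eq L F z (m : nat) : R :=
  \big[Num.max/0]_(J : {ffun 'I_n -> 'I_m.+1} | mdeg (mval J) == m)
    dquot L F z (mval J).

Definition max_dquot_le L F z (m : nat) : R :=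
  \big[Num.max/0]_(K : {ffun 'I_n -> 'I_m.+1} | (mdeg (mval K) <= m)%N)
    dquot L F z (mval K).

End LIndex.

(* Main.v *)
Require Import Defs.
From HB Require Import structures.
From mathcomp Require Import all_boot all_order all_algebra.
From mathcomp Require Import all_classical all_reals all_analysis.
From mathcomp Require Import cyclic separable cyclotomic complex ring lra.

Set Implicit Arguments.
Unset Strict Implicit.
Unset Printing Implicit Defensive.

Import Order.TTheory GRing.Theory Num.Theory.
Import numFieldNormedType.Exports.

Local Open Scope classical_set_scope.
Local Open Scope ring_scope.

(** If [F] has index [m], then the index inequality for [J] of degree [m + 1],
    multiplied by [J!], is the required bound with [p = m] and [c = (m + 1)!].

    Conversely, let [rho = beta / sqrt n], which exceeds 1. Around a point [z0]
    of the ball take the polydisc of radii [rho / L_j z0]. It lies in the ball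
    because [L_j z0] exceeds [beta / (1 - |z0|)], and on it all the [L_j] are
    comparable to their values at [z0], because [L] is of class Q. Freeze the
    weights at [z0] and consider the maximum [W] of [|F^(K)| / L(z0)^K] over
    the [K] of degree at most [p]. Differentiating [F^(K)] in one coordinate
    leads either to another term of the maximum or to a derivative of order
    [p + 1], which the hypothesis bounds by a constant times [W]. So [W] grows
    at most exponentially along coordinate segments, and an inequality of Gronwall type
    gives [W <= E * W(z0)] on the polydisc, with [E] independent of [z0]
    ([wmax_polydisc]). In particular [|F| <= E * W(z0)] there, and Cauchy's
    inequality on the polydisc ([cauchy_mderiv]) yields
    [|F^(J)(z0)| / (J! L(z0)^J) <= rho^(- |J|) * E * W(z0)]. Since [W(z0)] is at
    most [p!] times the maximum in the definition of the index, the right-hand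
    side is below that maximum as soon as [|J|] is large: the index is bounded.

    The function theory rests on power series. Term-by-term differentiation
    ([expansion_partial]) shows that all partial derivatives of [F] again have
    expansions around every point, and that they commute ([perm_dword]).
    Cauchy's inequality is proved without integration. Averaging a function of
    one variable over rotations by roots of unity removes its Taylor
    coefficients of order less than [k]; division by the [k]-th power of the
    variable then leaves a function whose value at 0 is the [k]-th coefficient,
    and the maximum principle compares this value with those on a circle
    ([cauchy_inequality]). The maximum principle in turn follows from Taylor
    expansions of order two: over the four points [x + t], [x - t], [x + it],
    [x - it] the terms of order one and two cancel, so that adding [e |x|^2] to
    the squared modulus excludes interior maxima ([no_perturbed_max]). Several
    variables are treated one at a time. *)

(** * The modulus *)

Section Modulus.
Variable R : realType.
Implicit Types (x y : Cplx R) (r : R).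

(** The norm of the numeric field [Cplx R] takes its values in [Cplx R]
    itself; [modulus] is the same number seen in [R], where the order is
    total. *)
Lemma normE x : `|x| = (modulus x)%:C%C :> Cplx R.
Proof. by []. Qed.

Lemma modulus_ge0 x : 0 <= modulus x.
Proof. by case: x => a b; exact: sqrtr_ge0. Qed.

Lemma modulus0 : modulus (0 : Cplx R) = 0.
Proof. exact: (@ComplexField.Normc.normc0 R). Qed.

Lemma modulus_eq0 x : modulus x = 0 -> x = 0.
Proof. exact: (@ComplexField.Normc.eq0_normc R x). Qed.

Lemma modulus_gt0 x : x != 0 -> 0 < modulus x.
Proof.
move=> x0; rewrite lt_neqAle modulus_ge0 andbT eq_sym.
by apply: contra_neq x0; exact: modulus_eq0.
Qed.

Lemma modulus1 : modulus (1 : Cplx R) = 1.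
Proof. exact: (@ComplexField.Normc.normc1 R). Qed.

Lemma modulusM x y : modulus (x * y) = modulus x * modulus y.
Proof. exact: (@ComplexField.Normc.normcM R x y). Qed.

Lemma modulusV x : modulus x^-1 = (modulus x)^-1.
Proof. exact: (@ComplexField.Normc.normcV R x). Qed.

Lemma ler_modulusD x y : modulus (x + y) <= modulus x + modulus y.
Proof. by have := ler_normD x y; rewrite !normE -rmorphD lecR. Qed.

Lemma modulusN x : modulus (- x) = modulus x.
Proof. by apply: (@complexI R); rewrite -!normE normrN. Qed.

Lemma modulusX x k : modulus (x ^+ k) = modulus x ^+ k.
Proof.
elim: k => [|k IH]; first by rewrite !expr0 modulus1.
by rewrite !exprS modulusM IH.
Qed.

Lemma modulus_distC x y : modulus (x - y) = modulus (y - x).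
Proof. by rewrite -modulusN opprB. Qed.

Lemma ler_modulusB x y : modulus (x - y) <= modulus x + modulus y.
Proof. by rewrite -(modulusN y) ler_modulusD. Qed.

Lemma ler_dist_modulus x y : `|modulus x - modulus y| <= modulus (x - y).
Proof.
rewrite ler_norml; apply/andP; split.
  have := ler_modulusD (y - x) x; rewrite subrK modulus_distC; lra.
have := ler_modulusD (x - y) y; rewrite subrK; lra.
Qed.

Lemma modulus_real r : modulus (r%:C%C : Cplx R) = `|r|.
Proof. by rewrite /modulus /= expr0n addr0 sqrtr_sqr. Qed.

Lemma modulus_nat k : modulus (k%:R : Cplx R) = k%:R.
Proof.
have -> : (k%:R : Cplx R) = ((k%:R : R)%:C)%C by rewrite rmorph_nat.
by rewrite modulus_real ger0_norm.
Qed.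

Lemma modulus_prod (I : Type) (s : seq I) (P : pred I) (c : I -> Cplx R) :
  modulus (\prod_(i <- s | P i) c i) = \prod_(i <- s | P i) modulus (c i).
Proof. exact: (big_morph _ modulusM modulus1). Qed.

Lemma ler_modulus_sum (I : Type) (s : seq I) (P : pred I) (c : I -> Cplx R) :
  modulus (\sum_(i <- s | P i) c i) <= \sum_(i <- s | P i) modulus (c i).
Proof.
elim/big_ind2 : _ => [|x a y b Hx Hy|i _]; rewrite ?modulus0 //.
by rewrite (le_trans (ler_modulusD _ _)) // lerD.
Qed.

Lemma modulus_sqr x : modulus x ^+ 2 = complex.Re x ^+ 2 + complex.Im x ^+ 2.
Proof. by case: x => a b; rewrite /modulus /= sqr_sqrtr // addr_ge0 ?sqr_ge0. Qed.

Lemma modulus_Re x : `|complex.Re x| <= modulus x.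
Proof.
rewrite -(@ler_pXn2r _ 2) ?nnegrE ?modulus_ge0 //.
by rewrite real_normK ?num_real // modulus_sqr lerDl sqr_ge0.
Qed.

Lemma modulus_Im x : `|complex.Im x| <= modulus x.
Proof.
rewrite -(@ler_pXn2r _ 2) ?nnegrE ?modulus_ge0 //.
by rewrite real_normK ?num_real // modulus_sqr lerDr sqr_ge0.
Qed.

End Modulus.

(** * Unconditional sums *)

Section Sums.
Variables (R : realType) (I : choiceType).
Implicit Types (c : I -> Cplx R) (r : I -> R) (s : seq I) (l : Cplx R).

(** Unconditional summation along the finite duplicate-free lists, ordered by
    inclusion of their supports. It makes a reindexing of the family, such as
    the shift of multi-indices in a differentiation, harmless. *)
Definition has_sum c l := forall e : R, 0 < e -> exists s0 : seq I,
  forall s, uniq s -> {subset s0 <= s} ->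
    modulus (\sum_(K <- s) c K - l) <= e.

Definition abs_bounded c (M : R) :=
  forall s, uniq s -> \sum_(K <- s) modulus (c K) <= M.

Lemma sum_restrict (V : nmodType) (f : I -> V) s t : uniq s -> uniq t ->
  {subset s <= t} -> \sum_(K <- t | K \in s) f K = \sum_(K <- s) f K.
Proof.
move=> us ut st; rewrite -big_filter; apply/perm_big/uniq_perm => //.
  exact: filter_uniq.
by move=> K; rewrite mem_filter; case: (boolP (K \in s)) => //= Ks; rewrite st.
Qed.

Lemma ler_sum_subset r s t : (forall K, 0 <= r K) -> uniq s ->
  {subset s <= t} -> \sum_(K <- s) r K <= \sum_(K <- t) r K.
Proof.
move=> r0 us st; wlog ut : t st / uniq t.
  move=> H; apply: (le_trans (H (undup t) _ (undup_uniq t))).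
    by move=> K Ks; rewrite mem_undup st.
  by elim: t {st H} => [|K t IH] //=; case: ifP => _;
    rewrite !big_cons ?lerD2l // (le_trans IH) // lerDr.
rewrite [leRHS](bigID (mem s)) /= sum_restrict // lerDl.
exact: sumr_ge0.
Qed.

(** A bounded nonnegative family sums to the supremum of its finite partial
    sums. *)
Lemma real_sum_ex r M : (forall K, 0 <= r K) ->
  (forall s, uniq s -> \sum_(K <- s) r K <= M) ->
  exists l : R, forall e, 0 < e -> exists s0 : seq I,
    forall s, uniq s -> {subset s0 <= s} -> `|\sum_(K <- s) r K - l| <= e.
Proof.
move=> r0 HM.
pose A := [set \sum_(K <- s) r K | s in [set s : seq I | uniq s]].
have supA : has_sup A.
  split; first by exists (\sum_(K <- [::]) r K), [::].
  by exists M => _ [s us <-]; exact: HM.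
exists (sup A) => e e0.
have [_ [s0 us0 <-] Hs0] := sup_adherent e0 supA.
exists s0 => s us sub.
have h1 : \sum_(K <- s) r K <= sup A by apply: sup_upper_bound => //; exists s.
have h2 := ler_sum_subset r0 us0 sub.
by rewrite ler_norml; apply/andP; split; lra.
Qed.

(** A real family [f] is the difference of the nonnegative families [f +
    `|f|] and [`|f|], and a complex family reduces to its real and imaginary
    parts; this replaces a Cauchy criterion. *)
Lemma has_sum_ex c M : abs_bounded c M -> exists l, has_sum c l.
Proof.
move=> cM.
have part (f : I -> R) : (forall K, `|f K| <= modulus (c K)) ->
    exists l : R, forall e, 0 < e -> exists s0 : seq I,
    forall s, uniq s -> {subset s0 <= s} -> `|\sum_(K <- s) f K - l| <= e.
  move=> fc.
  have [||l1 H1] := @real_sum_ex (fun K => `|f K|) M; first by [].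
    by move=> s us; apply: le_trans (cM s us); apply: ler_sum.
  have [||l2 H2] := @real_sum_ex (fun K => f K + `|f K|) (2 * M).
  - by move=> K; have := ler_norm (- f K); rewrite normrN; lra.
  - move=> s us; rewrite mulr_natl mulr2n; apply: le_trans (lerD (cM s us) (cM s us)).
    rewrite -big_split /=; apply: ler_sum => K _.
    by have := ler_norm (f K); have := fc K; lra.
  exists (l2 - l1) => e e0; have e20 : 0 < e / 2 by lra.
  have [s1 {}H1] := H1 _ e20; have [s2 {}H2] := H2 _ e20.
  exists (s1 ++ s2) => s us sub.
  have {}H1 : `|\sum_(K <- s) `|f K| - l1| <= e / 2.
    by apply: H1 => // K Ks; rewrite sub // mem_cat Ks.
  have {}H2 : `|\sum_(K <- s) (f K + `|f K|) - l2| <= e / 2.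
    by apply: H2 => // K Ks; rewrite sub // mem_cat Ks orbT.
  move: H1 H2; rewrite big_split /= !ler_norml => /andP[? ?] /andP[? ?].
  by apply/andP; split; lra.
have [a Ha] := part _ (fun K => modulus_Re (c K)).
have [b Hb] := part _ (fun K => modulus_Im (c K)).
exists (a +i* b)%C => e e0; have e20 : 0 < e / 2 by lra.
have [s1 {}Ha] := Ha _ e20; have [s2 {}Hb] := Hb _ e20.
exists (s1 ++ s2) => s us sub.
have {}Ha : `|\sum_(K <- s) complex.Re (c K) - a| <= e / 2.
  by apply: Ha => // K Ks; rewrite sub // mem_cat Ks.
have {}Hb : `|\sum_(K <- s) complex.Im (c K) - b| <= e / 2.
  by apply: Hb => // K Ks; rewrite sub // mem_cat Ks orbT.
have -> : \sum_(K <- s) c K - (a +i* b)%C =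
  ((\sum_(K <- s) complex.Re (c K) - a)%:C +
   (0 +i* 1) * (\sum_(K <- s) complex.Im (c K) - b)%:C)%C :> Cplx R.
  have -> : \sum_(K <- s) c K = ((\sum_(K <- s) complex.Re (c K)) +i*
      (\sum_(K <- s) complex.Im (c K)))%C :> Cplx R.
    elim: s {us sub Ha Hb} => [|K s IH]; first by rewrite !big_nil.
    by rewrite !big_cons IH; case: (c K).
  by apply/eqP; rewrite eq_complex /=; apply/andP; split; apply/eqP; ring.
rewrite (le_trans (ler_modulusD _ _)) // modulusM !modulus_real.
have -> : modulus ((0 +i* 1)%C : Cplx R) = 1.
  by rewrite /modulus /= expr0n expr1n add0r sqrtr1.
by rewrite mul1r (splitr e) lerD.
Qed.

Lemma has_sum_uniq c l1 l2 : has_sum c l1 -> has_sum c l2 -> l1 = l2.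
Proof.
move=> H1 H2; apply/eqP; rewrite -subr_eq0; apply/eqP/modulus_eq0/eqP.
rewrite eq_le modulus_ge0 andbT; apply/ler_addgt0Pl => e e0; rewrite addr0.
have e20 : 0 < e / 2 by lra.
have [s1 {}H1] := H1 _ e20; have [s2 {}H2] := H2 _ e20.
pose s := undup (s1 ++ s2).
have {}H1 : modulus (\sum_(K <- s) c K - l1) <= e / 2.
  by apply: H1; rewrite ?undup_uniq // => K Ks; rewrite mem_undup mem_cat Ks.
have {}H2 : modulus (\sum_(K <- s) c K - l2) <= e / 2.
  by apply: H2; rewrite ?undup_uniq // => K Ks; rewrite mem_undup mem_cat Ks orbT.
have -> : l1 - l2 = (\sum_(K <- s) c K - l2) - (\sum_(K <- s) c K - l1) by ring.
by have := ler_modulusB (\sum_(K <- s) c K - l2) (\sum_(K <- s) c K - l1); lra.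
Qed.

Lemma has_sum_lin c1 c2 l1 l2 (a : Cplx R) : has_sum c1 l1 -> has_sum c2 l2 ->
  has_sum (fun K => c1 K + a * c2 K) (l1 + a * l2).
Proof.
move=> H1 H2 e e0; pose A := modulus a + 1.
have A0 : 0 < A by rewrite /A; have := modulus_ge0 a; lra.
have e20 : 0 < e / 2 by lra.
have eA : 0 < e / 2 / A by rewrite divr_gt0.
have [s1 {}H1] := H1 _ e20; have [s2 {}H2] := H2 _ eA.
exists (s1 ++ s2) => s us sub.
have {}H1 : modulus (\sum_(K <- s) c1 K - l1) <= e / 2.
  by apply: H1 => // K Ks; rewrite sub // mem_cat Ks.
have {}H2 : modulus (\sum_(K <- s) c2 K - l2) <= e / 2 / A.
  by apply: H2 => // K Ks; rewrite sub // mem_cat Ks orbT.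
rewrite big_split /= -mulr_sumr.
have -> : \sum_(K <- s) c1 K + a * \sum_(K <- s) c2 K - (l1 + a * l2) =
  (\sum_(K <- s) c1 K - l1) + a * (\sum_(K <- s) c2 K - l2) by ring.
rewrite (le_trans (ler_modulusD _ _)) // modulusM (splitr e) lerD //.
have -> : e / 2 = A * (e / 2 / A) by field; rewrite gt_eqF.
by rewrite ler_pM ?modulus_ge0 // /A lerDl.
Qed.

(** Bounds on the finite partial sums pass to the sum. All the remainder
    estimates below are of this kind: they hold for finite sums term by term,
    with a constant that does not depend on the list. *)
Lemma has_sum_le c l (B : R) (s0 : seq I) :
  (forall s, uniq s -> {subset s0 <= s} -> modulus (\sum_(K <- s) c K) <= B) ->
  has_sum c l -> modulus l <= B.
Proof.
move=> cB H; apply/ler_addgt0Pl => e e0.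
have [s1 {}H] := H _ e0; pose s := undup (s0 ++ s1).
have {}H : modulus (\sum_(K <- s) c K - l) <= e.
  by apply: H; rewrite ?undup_uniq // => K Ks; rewrite mem_undup mem_cat Ks orbT.
have {}cB : modulus (\sum_(K <- s) c K) <= B.
  by apply: cB; rewrite ?undup_uniq // => K Ks; rewrite mem_undup mem_cat Ks.
have := ler_modulusB (\sum_(K <- s) c K) (\sum_(K <- s) c K - l).
by rewrite opprB addrCA subrr addr0; lra.
Qed.

Lemma has_sum_fin c t : uniq t -> (forall K, K \notin t -> c K = 0) ->
  has_sum c (\sum_(K <- t) c K).
Proof.
move=> ut c0 e e0; exists t => s us sub.
suff -> : \sum_(K <- s) c K = \sum_(K <- t) c K by rewrite subrr modulus0 ltW.
by rewrite (bigID (mem t)) /= [X in _ + X]big1 // addr0 sum_restrict.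
Qed.

End Sums.

(** * Monomials, multi-indices and multiple power series *)

Section Monomials.
Variable R : realType.
Implicit Types (x h : Cplx R) (d y : R).

(** The factor [(modulus x + d) ^+ k] plays the role of the binomial sum
    bounding the difference, without any expansion: both sides obey the same
    recursion in [k]. *)
Lemma exprD_sub1 x h d k : 0 < d -> modulus h <= d ->
  modulus ((x + h) ^+ k - x ^+ k) <= modulus h / d * (modulus x + d) ^+ k.
Proof.
move=> d0 hd; have t0 : 0 <= modulus h / d by rewrite divr_ge0 ?modulus_ge0 // ltW.
elim: k => [|k IH]; first by rewrite !expr0 subrr modulus0 mulr1.
have -> : (x + h) ^+ k.+1 - x ^+ k.+1 =
    x * ((x + h) ^+ k - x ^+ k) + h * (x + h) ^+ k by rewrite !exprS; ring.
rewrite (le_trans (ler_modulusD _ _)) // !modulusM modulusX.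
have -> : modulus h / d * (modulus x + d) ^+ k.+1 =
  modulus x * (modulus h / d * (modulus x + d) ^+ k) +
  modulus h * (modulus x + d) ^+ k.
  by rewrite [_ ^+ k.+1]exprS; field; rewrite gt_eqF.
apply: lerD; first by rewrite ler_wpM2l ?modulus_ge0.
rewrite ler_wpM2l ?modulus_ge0 // lerXn2r ?nnegrE ?modulus_ge0 //.
  by rewrite addr_ge0 ?modulus_ge0 // ltW.
by rewrite (le_trans (ler_modulusD _ _)) // lerD2l.
Qed.

(** The second-order analogue of [exprD_sub1]. Up to the factor [(modulus h /
    d) ^+ 2], its right-hand side is the same monomial at the slightly larger
    radius [modulus x + d], where the power series still converges. *)
Lemma exprD_sub2 x h d k : 0 < d -> modulus h <= d ->
  modulus ((x + h) ^+ k - x ^+ k - h * (k%:R * x ^+ k.-1)) <=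
    (modulus h / d) ^+ 2 * (modulus x + d) ^+ k.
Proof.
move=> d0 hd; elim: k => [|k IH].
  rewrite !expr0 mul0r mulr0 subrr subr0 modulus0 mulr1.
  by rewrite exprn_ge0 // divr_ge0 ?modulus_ge0 // ltW.
have -> : (x + h) ^+ k.+1 - x ^+ k.+1 - h * (k.+1%:R * x ^+ k.+1.-1) =
    x * ((x + h) ^+ k - x ^+ k - h * (k%:R * x ^+ k.-1)) +
    h * ((x + h) ^+ k - x ^+ k).
  case: k {IH} => [|k] /=; first by rewrite !expr1 !expr0; ring.
  by rewrite !exprS -[k.+2%:R]natr1; ring.
rewrite (le_trans (ler_modulusD _ _)) // !modulusM.
have -> : (modulus h / d) ^+ 2 * (modulus x + d) ^+ k.+1 =
  modulus x * ((modulus h / d) ^+ 2 * (modulus x + d) ^+ k) +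
  modulus h * (modulus h / d * (modulus x + d) ^+ k).
  by rewrite [_ ^+ k.+1]exprS; field; rewrite gt_eqF.
by rewrite lerD // ler_wpM2l ?modulus_ge0 // exprD_sub1.
Qed.

Lemma natr_expr_le y d k : 0 <= y -> 0 < d ->
  k.+1%:R * y ^+ k <= (y + d) ^+ k.+1 / d.
Proof.
move=> y0 d0; rewrite ler_pdivlMr //; elim: k => [|k IH].
  by rewrite expr0 expr1 !mul1r lerDr.
have -> : k.+2%:R * y ^+ k.+1 * d = y * (k.+1%:R * y ^+ k * d) + d * y ^+ k.+1.
  by rewrite -[k.+2%:R]natr1 exprS; ring.
have -> : (y + d) ^+ k.+2 = y * (y + d) ^+ k.+1 + d * (y + d) ^+ k.+1.
  by rewrite exprS; ring.
apply: lerD; first by rewrite ler_wpM2l.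
by rewrite ler_wpM2l ?(ltW d0) // lerXn2r ?nnegrE ?addr_ge0 ?lerDl ?(ltW d0).
Qed.

End Monomials.

Section MultiIndex.
Variables (S : comNzRingType) (n : nat).
Implicit Types (x : 'I_n -> S) (K : mindex n) (j : 'I_n).

Definition incr K j : mindex n := [ffun i => K i + (i == j)]%N.

Definition decr K j : mindex n := [ffun i => K i - (i == j)]%N.

Definition set_coord x j (v : S) : 'I_n -> S := fun i => if i == j then v else x i.

Definition mpow_but x j K : S := \prod_(i | i != j) x i ^+ K i.

Lemma incrE K j i : incr K j i = (K i + (i == j))%N. Proof. by rewrite ffunE. Qed.

Lemma incr_inj j : injective (incr^~ j).
Proof.
move=> K K' /ffunP H; apply/ffunP => i.
by have := H i; rewrite !incrE => /addIn.
Qed.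

Lemma decrK j K : (0 < K j)%N -> incr (decr K j) j = K.
Proof.
move=> K0; apply/ffunP => i; rewrite !ffunE.
by case: eqP => [->|_]; rewrite ?addn0 ?subn0 ?subnK.
Qed.

Lemma mpowE x j K : mpow x K = x j ^+ K j * mpow_but x j K.
Proof. by rewrite /mpow (bigD1 j). Qed.

Lemma mpow_but_set_coord x j v K : mpow_but (set_coord x j v) j K = mpow_but x j K.
Proof. by apply: eq_bigr => i /negbTE ij; rewrite /set_coord ij. Qed.

Lemma mpow_set_coord x j v K : mpow (set_coord x j v) K = v ^+ K j * mpow_but x j K.
Proof. by rewrite (mpowE _ j) mpow_but_set_coord /set_coord eqxx. Qed.

Lemma mpow_but_incr x j K : mpow_but x j (incr K j) = mpow_but x j K.
Proof. by apply: eq_bigr => i /negbTE ij; rewrite incrE ij addn0. Qed.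

End MultiIndex.

Section Expansion.
Variables (R : realType) (n : nat).
Implicit Types (z : 'rV[Cplx R]_n) (a : mindex n -> Cplx R) (j : 'I_n).
Implicit Types (F G : 'rV[Cplx R]_n -> Cplx R).

(** Absolute convergence is kept as a bound on all finite partial sums of the
    moduli, at every polyradius in the cube of side [e]; this is the form in
    which it is used and in which it is stable under differentiation. *)
Definition expansion z0 (e : R) a F : Prop :=
  (forall y : 'I_n -> R, (forall j, 0 <= y j < e) ->
     exists M, forall s, uniq s ->
       \sum_(K <- s) modulus (a K) * mpow y K <= M) /\
  forall z, (forall j, modulus (z ord0 j - z0 ord0 j) < e) ->
    has_sum (fun K => a K * mpow (fun j => z ord0 j - z0 ord0 j) K) (F z).

(** The coefficients of the derivative of the power series in the [j]-th
    variable. *)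
Definition dshift j a : mindex n -> Cplx R :=
  fun K => (K j).+1%:R * a (incr K j).

Lemma modulus_mpow (x : 'I_n -> Cplx R) (K : mindex n) :
  modulus (mpow x K) = mpow (fun j => modulus (x j)) K.
Proof. by rewrite modulus_prod; apply: eq_bigr => j _; rewrite modulusX. Qed.

Lemma modulus_mpow_but (x : 'I_n -> Cplx R) j (K : mindex n) :
  modulus (mpow_but x j K) = mpow_but (fun j => modulus (x j)) j K.
Proof. by rewrite modulus_prod; apply: eq_bigr => i _; rewrite modulusX. Qed.

Lemma mpow_ge0 (y : 'I_n -> R) (K : mindex n) :
  (forall j, 0 <= y j) -> 0 <= mpow y K.
Proof. by move=> y0; apply: prodr_ge0 => j _; rewrite exprn_ge0. Qed.

Lemma mpow_but_ge0 (y : 'I_n -> R) j (K : mindex n) :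
  (forall j, 0 <= y j) -> 0 <= mpow_but y j K.
Proof. by move=> y0; apply: prodr_ge0 => i _; rewrite exprn_ge0. Qed.

Lemma coord_shift z j (h : Cplx R) i :
  (z + h *: delta_mx ord0 j) ord0 i = z ord0 i + (if i == j then h else 0).
Proof. by rewrite !mxE eqxx /=; case: eqP; rewrite ?mulr1 ?mulr0. Qed.

(** The terms are absolutely summable, hence have an unconditional sum; the
    cubic partial sums are among the finite sums it controls, so their limit
    is that sum. *)
Lemma analytic_expansion (D : set 'rV[Cplx R]_n) F z0 : analytic_on D F ->
  D z0 -> exists (e : R) a, 0 < e /\ expansion z0 e a F.
Proof.
move=> aF /aF[e [a [e0 H]]]; exists e, a; split=> //.
have Hs y : (forall j, 0 <= y j < e) ->
     exists M, forall s, uniq s ->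
       \sum_(K <- s) modulus (a K) * mpow y K <= M.
  move=> ye; pose z : 'rV[Cplx R]_n := \row_j (z0 ord0 j + (y j)%:C%C).
  have zz j : z ord0 j - z0 ord0 j = (y j)%:C%C by rewrite mxE addrC addKr.
  have [|+ _] := H z.
    by move=> j; rewrite zz modulus_real ger0_norm; case/andP: (ye j).
  pose f (K : mindex n) :=
    `|(modulus (a K * mpow (fun j => z ord0 j - z0 ord0 j) K))%:E|%E.
  rewrite summableE -/(esum _ f) => fin.
  exists (fine (esum [set: mindex n] f)) => s us.
  rewrite -lee_fin fineK //.
  apply: esum_ge; exists [set` s]; first by split; [exact: finite_seq|].
  rewrite fsbig_finite /=; last exact: finite_seq.
  rewrite -sumEFin le_eqVlt; apply/orP; left; apply/eqP.
  transitivity (\sum_(K <- s) f K)%E; last first.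
    apply/perm_big/uniq_perm; rewrite ?finmap.fset_uniq // => K.
    by rewrite in_fset_set; [rewrite mem_setE|exact: finite_seq].
  apply: eq_bigr => K _; rewrite /f /= ger0_norm ?modulus_ge0 //.
  congr (_%:E); rewrite modulusM modulus_mpow; congr (_ * _).
  apply: eq_bigr => j _; rewrite zz modulus_real ger0_norm //.
  by case/andP: (ye j).
split=> // z ze; have [_ Hz] := H z ze.
pose c (K : mindex n) := a K * mpow (fun j => z ord0 j - z0 ord0 j) K.
rewrite -/c in Hz *.
have [M HM] : exists M, abs_bounded c M.
  have [|M HM] := Hs (fun j => modulus (z ord0 j - z0 ord0 j)).
    by move=> j; rewrite modulus_ge0 ze.
  exists M => s us; apply: le_trans (HM s us); apply: ler_sum => K _.
  by rewrite modulusM modulus_mpow.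
have [l Hl] := has_sum_ex HM.
suff -> : F z = l by [].
apply/eqP; rewrite -subr_eq0; apply/eqP/modulus_eq0/eqP.
rewrite eq_le modulus_ge0 andbT; apply/ler_addgt0Pl => d d0; rewrite addr0.
have d20 : 0 < d / 2 by lra.
have [s0 Hs0] := Hl _ d20.
have dC : 0 < (d / 2)%:C%C :> Cplx R by rewrite ltcR.
have /cvgrPdist_le /(_ _ dC) [N _ HN] := Hz.
(* A cube that contains the finite support [s0] given by summability. *)
pose N1 := (maxn N (\max_(K <- s0) \max_j K j).+1)%N.
have {HN} := HN N1 (leq_maxl _ _).
rewrite /= normE lecR => HN.
pose s := [seq mval K | K : {ffun 'I_n -> 'I_N1}].
have us : uniq s.
  rewrite map_inj_uniq ?enum_uniq // => K K' /ffunP E; apply/ffunP => i.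
  by apply: val_inj; have := E i; rewrite !ffunE.
have ss : {subset s0 <= s}.
  move=> K Ks.
  have KN i : (K i < N1)%N.
    rewrite leq_max; apply/orP; right; rewrite ltnS.
    apply: leq_trans (leq_bigmax_seq K Ks isT).
    exact: (leq_bigmax (F := fun j => K j) i).
  apply/mapP; exists [ffun i => Ordinal (KN i)]; first by rewrite mem_enum.
  by apply/ffunP => i; rewrite !ffunE.
have := Hs0 s us ss; rewrite big_image /= => H1.
have -> : F z - l = (F z - \sum_(K : {ffun 'I_n -> 'I_N1}) c (mval K)) +
  (\sum_(K : {ffun 'I_n -> 'I_N1}) c (mval K) - l) by ring.
rewrite (le_trans (ler_modulusD _ _)) // (splitr d) lerD //.
Qed.

End Expansion.

(** * Term-by-term differentiation *)

Lemma foldr_nseq (S T : Type) (f : S -> T -> T) (x : S) (y : T) k :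
  foldr f y (nseq k x) = iter k (f x) y.
Proof. by elim: k => [|k /= ->]. Qed.

Section Differentiation.
Variables (R : realType) (n : nat).
Implicit Types (z : 'rV[Cplx R]_n) (a : mindex n -> Cplx R) (j : 'I_n).
Implicit Types (F G : 'rV[Cplx R]_n -> Cplx R) (w : seq 'I_n).

(** Differentiability along the [j]-th coordinate, with a quadratic
    remainder. Power series give it directly, and it serves both for the
    directional derivative and for growth estimates along a segment. *)
Definition coord_deriv F z j (l : Cplx R) : Prop :=
  exists d C : R, 0 < d /\ forall h : Cplx R, modulus h <= d ->
    modulus (F (z + h *: delta_mx ord0 j) - F z - h * l) <= C * modulus h ^+ 2.

Lemma coord_deriv_partial F z j l : coord_deriv F z j l -> partial j F z = l.
Proof.
move=> [d [C [d0 H]]]; rewrite /partial /derive; apply: cvg_lim => //.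
apply/cvgrPdist_le => e e0.
have eE : e = (complex.Re e)%:C%C.
  by case: e e0 => u v; rewrite ltcE /= => /andP[/eqP -> _].
move: e0; rewrite eE ltcR; move: (complex.Re e) => {eE} r r0.
pose C' := `|C| + 1; have C'0 : 0 < C' by rewrite /C'; have := normr_ge0 C; lra.
have m0 : 0 < Num.min d (r / C') by rewrite lt_min d0 divr_gt0.
apply/nbhs_ballP; exists (Num.min d (r / C'))%:C%C; first by rewrite /= ltcR.
move=> h; rewrite /ball /= sub0r normrN normE ltcR lt_min => /andP[hd hr] h0.
rewrite normE lecR.
have mh : 0 < modulus h by apply: modulus_gt0.
have {}H := H h (ltW hd).
rewrite [h *: _ + z]addrC.
have -> : l - h^-1 *: (F (z + h *: delta_mx ord0 j) - F z) =
    - h^-1 * (F (z + h *: delta_mx ord0 j) - F z - h * l).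
  by rewrite /GRing.scale /=; field.
rewrite modulusM modulusN modulusV mulrC ler_pdivrMr //.
apply: (le_trans H); rewrite expr2 mulrA ler_wpM2r ?modulus_ge0 //.
have : C * modulus h <= C' * modulus h.
  by rewrite ler_wpM2r ?modulus_ge0 // /C'; have := ler_norm C; lra.
move=> /le_trans; apply.
by rewrite mulrC -ler_pdivlMr // ltW.
Qed.

(** Differentiation kills the terms with [K j = 0]; reindexing the others by
    [incr K j] identifies the derived series with the shifted one. *)
Lemma has_sum_incr (c : mindex n -> Cplx R) j l :
  (forall K : mindex n, K j = 0%N -> c K = 0) ->
  has_sum (fun K : mindex n => c (incr K j)) l -> has_sum c l.
Proof.
move=> c0 H e e0; have [s0 {}H] := H _ e0.
exists [seq incr K j | K <- s0] => s us sub.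
pose p (K : mindex n) := (0 < K j)%N.
(* Discarding the terms with [K j = 0] and shifting back yields a list
   that contains [s0]. *)
pose s' := [seq decr K j | K <- s & p K].
have us' : uniq s'.
  rewrite map_inj_in_uniq ?filter_uniq // => K K'.
  rewrite !mem_filter => /andP[K0 _] /andP[K'0 _] E.
  by rewrite -(decrK K0) -(decrK K'0) E.
have ss' : {subset s0 <= s'}.
  move=> K Ks; apply/mapP; exists (incr K j).
    by rewrite mem_filter /p incrE eqxx addn1 /= sub //; apply/mapP; exists K.
  by apply/ffunP => i; rewrite !ffunE addnK.
have := H s' us' ss'; rewrite big_map big_filter.
suff -> : \sum_(K <- s | p K) c (incr (decr K j) j) = \sum_(K <- s) c K by [].
rewrite [RHS](bigID p) /= [X in _ + X]big1 ?addr0.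
  by apply: eq_bigr => K K0; rewrite decrK.
by move=> K; rewrite -eqn0Ngt => /eqP /c0.
Qed.

(** The factor [(K j).+1] is absorbed by enlarging the [j]-th radius by [d],
    thanks to [natr_expr_le]. *)
Lemma expansion_dshift_bounded (e : R) a j :
  (forall y : 'I_n -> R, (forall j, 0 <= y j < e) ->
     exists M, forall s, uniq s ->
       \sum_(K <- s) modulus (a K) * mpow y K <= M) ->
  forall y : 'I_n -> R, (forall j, 0 <= y j < e) ->
     exists M, forall s, uniq s ->
       \sum_(K <- s) modulus (dshift j a K) * mpow y K <= M.
Proof.
move=> Ha y ye; have y0 i : 0 <= y i by case/andP: (ye i).
pose d := (e - y j) / 2.
have d0 : 0 < d by rewrite /d; case/andP: (ye j); lra.
have [|M HM] := Ha (set_coord y j (y j + d)).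
  move=> i; rewrite /set_coord; case: ifP => _ //.
  by have := d0; rewrite /d; case/andP: (ye j) => ? ? ?; apply/andP; split; lra.
exists (M / d) => s us.
have uis : uniq [seq incr K j | K <- s].
  by rewrite map_inj_uniq //; apply: incr_inj.
have := HM _ uis; rewrite big_map => /(ler_wpM2r (ltW (_ : 0 < d^-1))).
rewrite invr_gt0 => /(_ d0); apply: le_trans.
rewrite mulr_suml; apply: ler_sum => K _.
rewrite mpow_set_coord mpow_but_incr incrE eqxx addn1 (mpowE _ j) /dshift modulusM modulus_nat.
rewrite (_ : _ * _ * _ = modulus (a (incr K j)) * mpow_but y j K *
   ((K j).+1%:R * y j ^+ K j)); last by ring.
rewrite (_ : _ * _ / _ = modulus (a (incr K j)) * mpow_but y j K *
   ((y j + d) ^+ (K j).+1 / d)); last by ring.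
by rewrite ler_wpM2l ?natr_expr_le // mulr_ge0 ?modulus_ge0 ?mpow_but_ge0.
Qed.

(** Summing [exprD_sub2] over the multi-indices bounds the remainder of order
    two of [F] along the coordinate by the absolute sum of the series at the
    larger polyradius. *)
Lemma expansion_deriv z0 (e : R) a F j z : expansion z0 e a F ->
  (forall i, modulus (z ord0 i - z0 ord0 i) < e) ->
  exists l, has_sum (fun K => dshift j a K *
      mpow (fun i => z ord0 i - z0 ord0 i) K) l /\ coord_deriv F z j l.
Proof.
move=> [Ha HF] ze; pose x i := z ord0 i - z0 ord0 i.
have [|M0 HM0] := expansion_dshift_bounded j Ha (y := fun i => modulus (x i)).
  by move=> i; rewrite modulus_ge0 ze.
have [|l Hl] := @has_sum_ex _ _ (fun K => dshift j a K * mpow x K) M0.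
  move=> s us; rewrite (le_trans _ (HM0 s us)) //; apply: ler_sum => K _.
  by rewrite modulusM modulus_mpow.
exists l; split=> //.
pose c (K : mindex n) := a K * ((K j)%:R * x j ^+ (K j).-1 * mpow_but x j K).
have Hc : has_sum c l.
  apply: (@has_sum_incr _ j); first by move=> K K0; rewrite /c K0 !mul0r mulr0.
  suff -> : (fun K : mindex n => c (incr K j)) = (fun K => dshift j a K * mpow x K) by [].
  apply/funext => K; rewrite /c /dshift (mpowE _ j) mpow_but_incr incrE eqxx addn1 /=.
  by ring.
pose d := (e - modulus (x j)) / 2.
have d0 : 0 < d by rewrite /d; have := ze j; rewrite -/(x j); lra.
have de : modulus (x j) + d < e by have := d0; rewrite /d; lra.
have [|M HM] := Ha (set_coord (fun i => modulus (x i)) j (modulus (x j) + d)).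
  move=> i; rewrite /set_coord; case: ifP => _; last by rewrite modulus_ge0 ze.
  by rewrite de andbT addr_ge0 ?modulus_ge0 ?ltW.
exists d, (M / d ^+ 2); split=> // h hd.
have Hh : has_sum (fun K => a K * mpow (set_coord x j (x j + h)) K)
    (F (z + h *: delta_mx ord0 j)).
  have := HF (z + h *: delta_mx ord0 j).
  have -> : (fun i => (z + h *: delta_mx ord0 j) ord0 i - z0 ord0 i) =
      set_coord x j (x j + h).
    apply/funext => i; rewrite coord_shift /set_coord /x; case: eqP => [->|_]; ring.
  apply=> i; rewrite coord_shift; case: eqP => [->|_]; last by rewrite addr0 ze.
  rewrite (_ : _ - _ = x j + h); last by rewrite /x; ring.
  by apply: le_lt_trans (ler_modulusD _ _) _; apply: le_lt_trans de; rewrite lerD2l.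
have := has_sum_lin (- h) (has_sum_lin (-1) Hh (HF z ze)) Hc.
rewrite mulN1r mulNr; apply: (has_sum_le (s0 := [::])) => s us _.
rewrite (le_trans (ler_modulus_sum _ _ _)) //.
have := HM s us => /(ler_wpM2l (sqr_ge0 (modulus h / d))).
rewrite (_ : _ * M = M / d ^+ 2 * modulus h ^+ 2); last by field; rewrite gt_eqF.
apply: le_trans; rewrite mulr_sumr; apply: ler_sum => K _.
rewrite !mpow_set_coord (mpowE _ j) (_ : _ + _ = a K * mpow_but x j K *
  ((x j + h) ^+ K j - x j ^+ K j - h * ((K j)%:R * x j ^+ (K j).-1))); last first.
  by rewrite /c /x; ring.
rewrite modulusM modulusM modulus_mpow_but.
rewrite (_ : (_ / _) ^+ 2 * _ = modulus (a K) * mpow_but (fun i => modulus (x i)) j K *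
  ((modulus h / d) ^+ 2 * (modulus (x j) + d) ^+ K j)); last by ring.
rewrite ler_wpM2l ?exprD_sub2 // mulr_ge0 ?modulus_ge0 ?mpow_but_ge0 // => i.
exact: modulus_ge0.
Qed.

Lemma expansion_partial z0 (e : R) a F j : expansion z0 e a F ->
  expansion z0 e (dshift j a) (partial j F).
Proof.
move=> HF; split; first exact: (expansion_dshift_bounded j HF.1).
move=> z ze; have [l [Hl /coord_deriv_partial ->]] := expansion_deriv j HF ze.
exact: Hl.
Qed.

(** At the centre only the constant term survives. Reading derivatives off at
    the centre of their own expansion avoids any recentering of power series. *)
Lemma expansion_center z0 (e : R) a F : 0 < e -> expansion z0 e a F ->
  F z0 = a [ffun=> 0%N].
Proof.
move=> e0 [_ H]; have z0z0 j : modulus (z0 ord0 j - z0 ord0 j) < e.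
  by rewrite subrr modulus0.
pose K0 : mindex n := [ffun=> 0%N].
rewrite (has_sum_uniq (H z0 z0z0) (has_sum_fin (t := [:: K0]) _ _)) //.
  by rewrite big_seq1 /mpow big1 ?mulr1 // => j _; rewrite ffunE expr0.
move=> K; rewrite inE => KK0.
have [j Kj] : exists j, K j != 0%N.
  apply/existsP; apply: contraNT KK0 => /existsPn KK0; apply/eqP/ffunP => j.
  by rewrite ffunE; apply/eqP; rewrite -[_ == _]negbK KK0.
by rewrite (mpowE _ j) subrr expr0n (negbTE Kj) mul0r mulr0.
Qed.

(** The iterated partial derivative along a word of directions, the head of
    the word being outermost. Words make the interchange of partial
    derivatives a statement on permutations. *)
Definition dword w F := foldr (@partial R n) F w.

Lemma expansion_dword z0 (e : R) a F w : expansion z0 e a F ->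
  expansion z0 e (foldr (@dshift R n) a w) (dword w F).
Proof. by move=> H; elim: w => [|j w IH] //=; apply: expansion_partial. Qed.

Lemma dshiftC i j a : dshift i (dshift j a) = dshift j (dshift i a).
Proof.
have [-> //|ij] := eqVneq i j.
apply/funext => K; rewrite /dshift !incrE [j == i]eq_sym (negbTE ij) !addn0.
rewrite mulrCA; congr (_ * (_ * a _)).
by apply/ffunP => k; rewrite !ffunE addnAC.
Qed.

Lemma perm_foldr_dshift a w w' : perm_eq w w' ->
  foldr (@dshift R n) a w = foldr (@dshift R n) a w'.
Proof.
apply: catCA_perm_subst => {w w'} s1 s2 s3.
have swap j s t : foldr (@dshift R n) a (j :: s ++ t) =
    foldr (@dshift R n) a (s ++ j :: t).
  by elim: s => [|i s /= IH] //=; rewrite dshiftC IH.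
elim: s1 => [|j s1 IH] //=; rewrite IH; exact: swap.
Qed.

Definition word (K : mindex n) := flatten [seq nseq (K j) j | j <- enum 'I_n].

Lemma foldr_partial_dword (K : 'I_n -> nat) F s :
  foldr (fun j G => iter (K j) (partial j) G) F s =
  dword (flatten [seq nseq (K j) j | j <- s]) F.
Proof.
elim: s => [|j s IH] //=.
rewrite /dword foldr_cat -/(dword (flatten _) F) -IH.
by rewrite foldr_nseq.
Qed.

Lemma mderiv_dword K F : mderiv K F = dword (word K) F.
Proof. exact: foldr_partial_dword. Qed.

Lemma count_word K j : count_mem j (word K) = K j.
Proof.
rewrite /word count_flatten -map_comp sumnE big_map big_enum /= (bigD1 j) //=.
rewrite big1 => [|i /negbTE ij]; first by rewrite count_nseq /= eqxx mul1n addn0.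
by rewrite count_nseq /= ij.
Qed.

Lemma perm_word_incr K j : perm_eq (j :: word K) (word (incr K j)).
Proof.
rewrite /perm_eq; apply/allP => i _ /=.
by rewrite !count_word incrE addnC [j == i]eq_sym.
Qed.

Section OnDomain.
Variables (D : set 'rV[Cplx R]_n) (F : 'rV[Cplx R]_n -> Cplx R).
Hypothesis aF : analytic_on D F.

(** Partial derivatives commute because the coefficient shifts do: both sides
    are the constant coefficient of the same series. *)
Lemma perm_dword w w' z : D z -> perm_eq w w' -> dword w F z = dword w' F z.
Proof.
move=> /(analytic_expansion aF) [e [a [e0 H]]] ww'.
rewrite (expansion_center e0 (expansion_dword w H)).
by rewrite (expansion_center e0 (expansion_dword w' H)) (perm_foldr_dshift _ ww').
Qed.

Lemma dword_deriv w z j : D z -> coord_deriv (dword w F) z j (dword (j :: w) F z).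
Proof.
move=> /(analytic_expansion aF) [e [a [e0 H]]].
have [|l [_ Hl]] := expansion_deriv j (expansion_dword w H) (z := z).
  by move=> i; rewrite subrr modulus0.
by rewrite /= (coord_deriv_partial Hl).
Qed.

Lemma mderiv_deriv K z j : D z ->
  coord_deriv (mderiv K F) z j (mderiv (incr K j) F z).
Proof.
move=> Dz; rewrite !mderiv_dword -(perm_dword Dz (perm_word_incr K j)).
exact: dword_deriv.
Qed.

End OnDomain.

End Differentiation.

(** * The maximum principle and Cauchy's inequality in one variable *)

Section Jets.
Variable R : realType.
Implicit Types (g q : Cplx R -> Cplx R) (x h : Cplx R) (c : nat -> Cplx R).

(** Taylor expansions are asserted without reference to derivatives, so that
    they pass directly to quotients and to averages over rotations. *)
Definition jet g x c (m : nat) := exists d C : R, 0 < d /\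
  forall h, modulus h <= d ->
    modulus (g (x + h) - \sum_(k < m) c k * h ^+ k) <= C * modulus h ^+ m.

Definition has_jet3 g x := exists c, jet g x c 3.

Lemma jet_bound g x c m : jet g x c m -> exists d C : R, [/\ 0 < d, 0 <= C &
  forall h, modulus h <= d ->
    modulus (g (x + h) - \sum_(k < m) c k * h ^+ k) <= C * modulus h ^+ m].
Proof.
move=> [d [C [d0 H]]]; exists d, `|C|; split=> // h hd.
apply: le_trans (H h hd) _; rewrite ler_wpM2r ?exprn_ge0 ?modulus_ge0 //.
exact: ler_norm.
Qed.

Lemma jet_lin g1 g2 x c1 c2 (a : Cplx R) m : jet g1 x c1 m -> jet g2 x c2 m ->
  jet (fun y => g1 y + a * g2 y) x (fun k => c1 k + a * c2 k) m.
Proof.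
move=> [d1 [C1 [d10 H1]]] [d2 [C2 [d20 H2]]].
exists (Num.min d1 d2), (C1 + modulus a * C2); split; first by rewrite lt_min d10.
move=> h; rewrite le_min => /andP[/H1 {}H1 /H2 {}H2].
have -> : g1 (x + h) + a * g2 (x + h) -
    \sum_(k < m) (c1 k + a * c2 k) * h ^+ k =
  (g1 (x + h) - \sum_(k < m) c1 k * h ^+ k) +
  a * (g2 (x + h) - \sum_(k < m) c2 k * h ^+ k).
  rewrite mulrBr mulr_sumr addrACA -opprD -big_split /=.
  by congr (_ - _); apply: eq_bigr => k _; ring.
rewrite (le_trans (ler_modulusD _ _)) // modulusM mulrDl lerD // -mulrA.
by rewrite ler_wpM2l ?modulus_ge0.
Qed.

Lemma jet0 x m : jet (fun=> 0) x (fun=> 0) m.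
Proof.
exists 1, 0; split=> // h _; rewrite big1 ?subrr ?modulus0 ?mul0r // => k _.
by rewrite mul0r.
Qed.

Lemma jet_sum (N : nat) (a : nat -> Cplx R) (g : nat -> Cplx R -> Cplx R) x
    (c : nat -> nat -> Cplx R) m :
  (forall i, jet (g i) x (c i) m) ->
  jet (fun y => \sum_(i < N) a i * g i y) x
      (fun k => \sum_(i < N) a i * c i k) m.
Proof.
move=> H; elim: N => [|N IH].
  have -> : (fun y => \sum_(i < 0) a i * g i y) = fun=> 0.
    by apply/funext => y; rewrite big_ord0.
  have -> : (fun k => \sum_(i < 0) a i * c i k) = fun=> 0.
    by apply/funext => y; rewrite big_ord0.
  exact: jet0.
have := jet_lin (a N) IH (H N).
congr (jet _ _ _ _); apply/funext => y; by rewrite big_ord_recr.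
Qed.

(** The factor [w] is a rotation, so that the remainder bound is unchanged. *)
Lemma jet_rot g x c m (w : Cplx R) : modulus w = 1 -> jet g (w * x) c m ->
  jet (fun y => g (w * y)) x (fun k => c k * w ^+ k) m.
Proof.
move=> w1 [d [C [d0 H]]]; exists d, C; split=> // h hd.
have := H (w * h); rewrite modulusM w1 mul1r => /(_ hd).
rewrite mulrDr; congr (modulus (_ - _) <= _).
by apply: eq_bigr => k _; rewrite exprMn; ring.
Qed.

Lemma jet3_sum (c : nat -> Cplx R) h :
  \sum_(k < 3) c k * h ^+ k = c 0%N + c 1%N * h + c 2%N * h ^+ 2.
Proof. by rewrite !big_ord_recl big_ord0 /= /bump /= expr0 expr1; ring. Qed.

(** The Taylor polynomial [u + v h + w h^2] of the quotient is obtained by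
    division by increasing powers: multiplied by [x + h] it agrees with that
    of [g] up to the term [w h^3]. *)
Lemma has_jet3_div g x : x != 0 -> has_jet3 g x ->
  has_jet3 (fun y => g y / y) x.
Proof.
move=> x0 [c /jet_bound[d [C [d0 C0 H]]]].
have mx : 0 < modulus x by apply: modulus_gt0.
pose u := c 0%N / x; pose v := (c 1%N - u) / x; pose w := (c 2%N - v) / x.
exists (fun k => nth 0 [:: u; v; w] k).
exists (Num.min d (modulus x / 2)), ((C + modulus w) * (2 / modulus x)).
split; first by rewrite lt_min d0 divr_gt0.
move=> h; rewrite le_min => /andP[/H]; rewrite !jet3_sum /= => {}H hx.
have mxh : modulus x / 2 <= modulus (x + h).
  by have := ler_modulusD (x + h) (- h); rewrite addrK modulusN; lra.
have mxh0 : 0 < modulus (x + h) by apply: lt_le_trans mxh; rewrite divr_gt0.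
have xh0 : x + h != 0.
  by apply: contraTneq mxh0 => ->; rewrite modulus0 ltxx.
have -> : g (x + h) / (x + h) - (u + v * h + w * h ^+ 2) =
  ((g (x + h) - (c 0%N + c 1%N * h + c 2%N * h ^+ 2)) - w * h ^+ 3) / (x + h).
  by rewrite /w /v /u; field; rewrite ?x0 ?xh0.
rewrite modulusM modulusV.
have H1 : modulus (g (x + h) - (c 0%N + c 1%N * h + c 2%N * h ^+ 2) - w * h ^+ 3)
    <= (C + modulus w) * modulus h ^+ 3.
  rewrite (le_trans (ler_modulusB _ _)) // modulusM modulusX mulrDl.
  by rewrite lerD2r.
have H2 : (modulus (x + h))^-1 <= 2 / modulus x.
  by rewrite -[2 / _]invrK invf_div lef_pV2 ?posrE ?divr_gt0.
rewrite [leRHS]mulrAC; apply: ler_pM H1 H2; rewrite ?modulus_ge0 //.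
by rewrite invr_ge0 modulus_ge0.
Qed.

Lemma jet_local g1 g2 x c m (r : R) : 0 < r ->
  (forall h, modulus h <= r -> g1 (x + h) = g2 (x + h)) ->
  jet g1 x c m -> jet g2 x c m.
Proof.
move=> r0 E [d [C [d0 H]]]; exists (Num.min d r), C.
split; first by rewrite lt_min d0.
by move=> h; rewrite le_min => /andP[hd hr]; rewrite -E // H.
Qed.

Lemma jet3_value g x c : jet g x c 3 -> c 0%N = g x.
Proof.
move=> [d [C [d0 H]]]; have := H 0.
rewrite modulus0 jet3_sum !expr0n /= !mulr0 !addr0 => /(_ (ltW d0)).
move=> H0; apply/esym/eqP; rewrite -subr_eq0; apply/eqP/modulus_eq0/eqP.
by rewrite eq_le H0 modulus_ge0.
Qed.

Lemma has_jet3_continuous q x : has_jet3 q x -> forall e : R, 0 < e ->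
  exists d : R, 0 < d /\
    forall h, modulus h <= d -> modulus (q (x + h) - q x) <= e.
Proof.
move=> [c Hc]; have c0 := jet3_value Hc; have [d [C [d0 C0 H]]] := jet_bound Hc.
move=> e e0; pose A := modulus (c 1%N) + modulus (c 2%N) + C + 1.
have A0 : 0 < A.
  by rewrite /A; have := modulus_ge0 (c 1%N); have := modulus_ge0 (c 2%N); lra.
exists (Num.min (Num.min d 1) (e / A)); split.
  by rewrite !lt_min d0 ltr01 divr_gt0.
move=> h; rewrite !le_min => /andP[/andP[/H {}H h1] he].
have h0 := modulus_ge0 h.
have -> : q (x + h) - q x = (q (x + h) - \sum_(k < 3) c k * h ^+ k) +
  (c 1%N * h + c 2%N * h ^+ 2) by rewrite jet3_sum c0; ring.
have H2 : modulus (c 1%N * h + c 2%N * h ^+ 2) <=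
    modulus (c 1%N) * modulus h + modulus (c 2%N) * modulus h ^+ 2.
  by rewrite (le_trans (ler_modulusD _ _)) // !modulusM expr2.
have h2 : modulus h ^+ 2 <= modulus h by rewrite expr2 ler_piMr.
have h3 : modulus h ^+ 3 <= modulus h by rewrite exprS ler_piMr ?exprn_ile1.
have := ler_wpM2l (modulus_ge0 (c 2%N)) h2.
have := ler_wpM2l C0 h3.
have : A * modulus h <= e by rewrite mulrC -ler_pdivlMr.
have := ler_modulusD (q (x + h) - \sum_(k < 3) c k * h ^+ k)
  (c 1%N * h + c 2%N * h ^+ 2).
rewrite /A; lra.
Qed.

Lemma modulus_ri (a b : R) : modulus ((a +i* b)%C : Cplx R) <= `|a| + `|b|.
Proof.
rewrite -(@ler_pXn2r _ 2) ?nnegrE ?modulus_ge0 ?addr_ge0 //.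
rewrite modulus_sqr /= -(real_normK (num_real a)) -(real_normK (num_real b)).
by have := mulr_ge0 (normr_ge0 a) (normr_ge0 b); nra.
Qed.

(** The closed disc is compact, as a closed subset of a square, and a
    function with a Taylor expansion at each of its points is continuous
    there. *)
Lemma perturbed_modulus_max q (r e : R) : 0 < r ->
  (forall x, modulus x <= r -> has_jet3 q x) ->
  exists x, modulus x <= r /\ forall y, modulus y <= r ->
    modulus (q y) ^+ 2 + e * modulus y ^+ 2 <=
    modulus (q x) ^+ 2 + e * modulus x ^+ 2.
Proof.
move=> r0 Hq.
pose z (p : R * R) : Cplx R := (p.1 +i* p.2)%C.
pose N (p : R * R) : R := p.1 * p.1 + p.2 * p.2.
have zN p : modulus (z p) ^+ 2 = N p by rewrite modulus_sqr !expr2.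
(* The squares are written as products, for which continuity is direct. *)
pose f (p : R * R) : R := modulus (q (z p)) * modulus (q (z p)) + e * N p.
pose A := [set p : R * R | N p <= r ^+ 2].
have zA p : A p -> modulus (z p) <= r.
  by rewrite /A /= -zN ler_pXn2r ?nnegrE ?modulus_ge0 ?(ltW r0).
have cN : continuous N.
  by move=> p; apply: cvgD; apply: cvgM; (exact: cvg_fst || exact: cvg_snd).
have cA : compact A.
  apply: (@subclosed_compact _ _ (`[-r, r] `*` `[-r, r])).
  - have -> : A = N @^-1` [set y | y <= r ^+ 2] by [].
    by move/continuous_closedP: cN; apply; exact: closed_le.
  - by apply: compact_setX; exact: segment_compact.
  move=> p /zA pr; split; rewrite /= in_itv /= -ler_norml.
    exact: le_trans (modulus_Re (z p)) pr.
  exact: le_trans (modulus_Im (z p)) pr.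
have A0 : A !=set0 by exists (0, 0); rewrite /A /= /N /= mulr0 addr0 exprn_ge0 // ltW.
have cf : {within A, continuous f}.
  apply: continuous_in_subspaceT => p; rewrite inE => Ap.
  suff cq : (fun p => modulus (q (z p))) @ p --> modulus (q (z p)).
    apply: cvgD; first exact: (cvgM cq cq).
    by apply: cvgM; [exact: cvg_cst|exact: cN].
  apply/cvgrPdist_le => d d0.
  have [eta [eta0 H]] := has_jet3_continuous (Hq _ (zA _ Ap)) d0.
  have eta2 : 0 < eta / 2 by rewrite divr_gt0.
  apply: filterS (nbhsx_ballx (p : (R * R)%type) (eta / 2) eta2) => p' [b1 b2] /=.
  rewrite (le_trans (ler_dist_modulus _ _)) // modulus_distC.
  have -> : z p' = z p + ((p'.1 - p.1) +i* (p'.2 - p.2))%C.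
    by rewrite /z; apply/eqP; rewrite eq_complex /=; apply/andP; split; apply/eqP; ring.
  apply: H; apply: (le_trans (modulus_ri _ _)).
  move: b1 b2; rewrite /ball /= => b1 b2.
  by rewrite (splitr eta) distrC [X in _ + X]distrC lerD // ltW.
have [p Ap Hp] := compact_EVT_max A0 cA cf.
exists (z p); split; first by apply: zA; rewrite inE in Ap.
move=> y yr; have := Hp (complex.Re y, complex.Im y).
have zy : z (complex.Re y, complex.Im y) = y by case: y {yr}.
rewrite /f -!zN zy -!expr2; apply.
by rewrite inE /A /= -zN zy ler_pXn2r ?nnegrE ?modulus_ge0 ?(ltW r0).
Qed.

End Jets.

Section Cauchy.
Variable R : realType.
Implicit Types (g q : Cplx R -> Cplx R) (x h : Cplx R) (c : nat -> Cplx R).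

Definition imag_unit : Cplx R := (0 +i* 1)%C.

Lemma imag_unit_sqr : imag_unit * imag_unit = -1.
Proof. by apply/eqP; rewrite eq_complex /=; apply/andP; split; apply/eqP; ring. Qed.

(** Summing over the four directions [T], [-T], [S], [-S] with [S ^ 2 = - T ^
    2] cancels the terms of order one and two of a Taylor expansion. *)
Lemma four_point_sum (T S c0 c1 c2 u1 u2 u3 u4 : Cplx R) : S * S = - (T * T) ->
  u1 + u2 + u3 + u4 = 4%:R * c0 +
    ((u1 - (c0 + c1 * T + c2 * T ^+ 2)) +
     (u2 - (c0 + c1 * - T + c2 * (- T) ^+ 2)) +
     (u3 - (c0 + c1 * S + c2 * S ^+ 2)) +
     (u4 - (c0 + c1 * - S + c2 * (- S) ^+ 2))).
Proof.
move=> ST; rewrite !expr2 !mulrNN ST; ring.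
Qed.

(** The same four directions as in [four_point_sum]: the linear terms cancel,
    but the quadratic ones add up, since the squared modulus is not
    holomorphic. *)
Lemma four_point_modulus (T S x : Cplx R) (t : R) : S = imag_unit * T -> T = t%:C%C ->
  modulus (x + T) ^+ 2 + modulus (x + - T) ^+ 2 +
    modulus (x + S) ^+ 2 + modulus (x + - S) ^+ 2 =
  4 * modulus x ^+ 2 + 4 * t ^+ 2.
Proof. by move=> -> ->; rewrite !modulus_sqr; case: x => u v /=; ring. Qed.

Lemma modulus_sum4 (u1 u2 u3 u4 : Cplx R) (B : R) :
  modulus u1 <= B -> modulus u2 <= B -> modulus u3 <= B -> modulus u4 <= B ->
  modulus (u1 + u2 + u3 + u4) <= 4 * B.
Proof.
move=> H1 H2 H3 H4; have := ler_modulusD u1 u2.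
have := ler_modulusD (u1 + u2) u3; have := ler_modulusD (u1 + u2 + u3) u4.
by lra.
Qed.

(** The real scalar product of two complex numbers. Linearising the squared
    modulus by [dot_le_sqr] turns identities for sums of values of [q] into
    bounds for sums of squared moduli. *)
Definition dot (u v : Cplx R) : R :=
  complex.Re u * complex.Re v + complex.Im u * complex.Im v.

Lemma modulus_sqr_dot u : modulus u ^+ 2 = dot u u.
Proof. by rewrite modulus_sqr !expr2. Qed.

Lemma dotD u v w : dot u (v + w) = dot u v + dot u w.
Proof. by rewrite /dot !raddfD /=; ring. Qed.

Lemma dot_natl u v k : dot u (k%:R * v) = k%:R * dot u v.
Proof. by rewrite /dot mulr_natl !raddfMn !mulrnAr -mulrnDl mulr_natl. Qed.

Lemma dot_le_sqr u v : 2 * dot u v - modulus u ^+ 2 <= modulus v ^+ 2.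
Proof.
rewrite !modulus_sqr_dot /dot; case: u v => a b [c d] /=.
by have := sqr_ge0 (a - c); have := sqr_ge0 (b - d); nra.
Qed.

Lemma dot_ge u v : - (2 * modulus u * modulus v) <= dot u v.
Proof.
have Hr := ler_pM (normr_ge0 _) (normr_ge0 _) (modulus_Re u) (modulus_Re v).
have Hi := ler_pM (normr_ge0 _) (normr_ge0 _) (modulus_Im u) (modulus_Im v).
have := ler_norm (- (complex.Re u * complex.Re v)).
have := ler_norm (- (complex.Im u * complex.Im v)).
by rewrite /dot !normrN !normrM; lra.
Qed.

(** The arithmetic of [no_perturbed_max]: [Q1] to [Q4] and [X1] to [X4] stand
    for the squared moduli of the values and of the points, [t2] for the
    square of [t], and [DS] for the scalar product with the sum of the four
    remainders. *)
Lemma four_point_contradiction (e t2 Q X A C t Q1 Q2 Q3 Q4 X1 X2 X3 X4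
    D1 D2 D3 D4 DS mS : R) :
  Q1 + e * X1 <= Q + e * X -> Q2 + e * X2 <= Q + e * X ->
  Q3 + e * X3 <= Q + e * X -> Q4 + e * X4 <= Q + e * X ->
  X1 + X2 + X3 + X4 = 4 * X + 4 * t2 ->
  2 * D1 - Q <= Q1 -> 2 * D2 - Q <= Q2 -> 2 * D3 - Q <= Q3 -> 2 * D4 - Q <= Q4 ->
  D1 + D2 + D3 + D4 = 4 * Q + DS -> - (A * mS) <= DS ->
  A * mS <= A * (4 * (C * (t * t2))) -> 2 * A * C * t * t2 < e * t2 -> False.
Proof.
move=> H1 H2 H3 H4 /(congr1 ( *%R e)) HX L1 L2 L3 L4 HD cross mAS key.
rewrite !mulrDr in HX; lra.
Qed.

(** Average over the four points at distance [t] of [x]: the squared modulus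
    of [q] loses at most [O(t^3)] by [four_point_sum], while the term [e *
    modulus x ^+ 2] gains [e * t ^+ 2]. For small [t] the average, hence one
    of the four values, exceeds the value at [x]. *)
Lemma no_perturbed_max q x (e d : R) : 0 < e -> 0 < d -> has_jet3 q x ->
  exists h, modulus h <= d /\
    modulus (q x) ^+ 2 + e * modulus x ^+ 2 <
    modulus (q (x + h)) ^+ 2 + e * modulus (x + h) ^+ 2.
Proof.
move=> e0 d0 [c Hc]; have c0 := jet3_value Hc.
have [d1 [C [d10 C0 H]]] := jet_bound Hc.
apply/not_existsP => Hmax.
have {}Hmax h : modulus h <= d ->
    modulus (q (x + h)) ^+ 2 + e * modulus (x + h) ^+ 2 <=
    modulus (q x) ^+ 2 + e * modulus x ^+ 2.
  by move=> hd; rewrite leNgt; apply/negP => ?; apply: (Hmax h).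
pose A := 2 * modulus (q x).
have A0 : 0 <= A by rewrite mulr_ge0 ?modulus_ge0.
have B0 : 0 < 2 * A * C + 1 by have := mulr_ge0 A0 C0; clear -R; lra.
(* So small that the cubic loss [2 * A * C * t ^+ 3] is less than the gain
   [e * t ^+ 2]. *)
pose t := Num.min (Num.min d d1) (e / (2 * A * C + 1)).
have t0 : 0 < t by rewrite !lt_min d0 d10 divr_gt0.
have [td td1 te] : [/\ t <= d, t <= d1 & 2 * A * C * t < e].
  split; first by rewrite !ge_min lexx.
    by rewrite !ge_min lexx orbT.
  have : t <= e / (2 * A * C + 1) by rewrite ge_min lexx orbT.
  by rewrite ler_pdivlMr // mulrDr mulr1 [t * _]mulrC; lra.
pose T : Cplx R := t%:C%C.
have mT : modulus T = t by rewrite modulus_real gtr0_norm.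
have mci : modulus (imag_unit * T) = t.
  by rewrite modulusM mT /modulus /= expr0n expr1n add0r sqrtr1 mul1r.
pose E h := q (x + h) - \sum_(k < 3) c k * h ^+ k.
have EE h : E h = q (x + h) - (q x + c 1%N * h + c 2%N * h ^+ 2).
  by rewrite /E jet3_sum c0.
have HE h : modulus h = t -> modulus (E h) <= C * t ^+ 3.
  by move=> ht; have := H h; rewrite ht; exact.
clearbody E; have E1 := HE _ mT.
have E2 := HE (- T); rewrite modulusN in E2; have {}E2 := E2 mT.
have E3 := HE _ mci.
have E4 := HE (- (imag_unit * T)); rewrite modulusN in E4; have {}E4 := E4 mci.
have sumq : q (x + T) + q (x + - T) + q (x + imag_unit * T) + q (x + - (imag_unit * T)) =
    4%:R * q x + (E T + E (- T) + E (imag_unit * T) + E (- (imag_unit * T))).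
  rewrite !EE; apply: four_point_sum.
  by rewrite mulrACA imag_unit_sqr mulN1r.
pose S := E T + E (- T) + E (imag_unit * T) + E (- (imag_unit * T)).
have mS : modulus S <= 4 * (C * t ^+ 3) by apply: modulus_sum4.
rewrite -/S in sumq; clearbody S.
have M1 := Hmax T; rewrite mT in M1; have {}M1 := M1 td.
have M2 := Hmax (- T); rewrite modulusN mT in M2; have {}M2 := M2 td.
have M3 := Hmax (imag_unit * T); rewrite mci in M3; have {}M3 := M3 td.
have M4 := Hmax (- (imag_unit * T)); rewrite modulusN mci in M4; have {}M4 := M4 td.
have sqx := four_point_modulus x (erefl (imag_unit * T)) (erefl T).
have L1 := dot_le_sqr (q x) (q (x + T)).
have L2 := dot_le_sqr (q x) (q (x + - T)).
have L3 := dot_le_sqr (q x) (q (x + imag_unit * T)).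
have L4 := dot_le_sqr (q x) (q (x + - (imag_unit * T))).
have := congr1 (dot (q x)) sumq.
rewrite !dotD dot_natl -modulus_sqr_dot => sdot.
have cross := dot_ge (q x) S; rewrite -/A in cross.
have mAS := ler_wpM2l A0 mS.
have key : 2 * A * C * t * t ^+ 2 < e * t ^+ 2 by rewrite ltr_pM2r ?exprn_gt0.
rewrite (exprS t 2) in mAS.
move: M1 M2 M3 M4 sqx L1 L2 L3 L4 sdot cross mAS key.
exact: four_point_contradiction.
Qed.

(** The maximum of [modulus (q x) ^+ 2 + e * modulus x ^+ 2] over the disc
    cannot be interior by [no_perturbed_max]; on the circle it is at most [B
    ^+ 2 + e * r ^+ 2], and [e] is arbitrary. *)
Lemma maximum_principle q (r B : R) : 0 < r ->
  (forall x, modulus x <= r -> has_jet3 q x) ->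
  (forall x, modulus x = r -> modulus (q x) <= B) -> modulus (q 0) <= B.
Proof.
move=> r0 Hq HB.
have B0 : 0 <= B.
  apply: le_trans (modulus_ge0 _) (HB (r%:C)%C _).
  by rewrite modulus_real gtr0_norm.
rewrite -(@ler_pXn2r _ 2) ?nnegrE ?modulus_ge0 //.
apply/ler_addgt0Pl => d d0.
pose e := d / r ^+ 2; have e0 : 0 < e by rewrite divr_gt0 ?exprn_gt0.
have [x [xr Hx]] := perturbed_modulus_max e r0 Hq.
have xE : modulus x = r.
  apply/eqP; rewrite eq_le xr leNgt; apply/negP => xr'.
  have [h [hd]] := @no_perturbed_max q x e (r - modulus x) e0
    (etrans (subr_gt0 _ _) xr') (Hq x xr).
  rewrite ltNge Hx //; have := ler_modulusD x h; lra.
have := Hx 0; rewrite modulus0 => /(_ (ltW r0)).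
rewrite xE expr0n mulr0 addr0 => /le_trans; apply.
rewrite addrC lerD ?lerXn2r ?nnegrE ?modulus_ge0 ?HB //.
by rewrite /e divfK // gt_eqF ?exprn_gt0.
Qed.

(** The polynomial [X^n - 1] splits over a closed field and is separable in
    characteristic zero. *)
Lemma primitive_root_exists (n : nat) : (0 < n)%N ->
  exists w : Cplx R, n.-primitive_root w.
Proof.
move=> n_gt0; pose p : {poly Cplx R} := 'X^n - 1.
have [r Dp] := closed_field_poly_normal p.
rewrite (monicP _) ?monicXnsubC // scale1r in Dp.
have rn1: all n.-unity_root r by apply/allP=> z; rewrite -root_prod_XsubC -Dp.
have sz_r: (n < (size r).+1)%N.
  by rewrite -(size_prod_XsubC r id) -Dp size_XnsubC.
have [|z] := hasP (has_prim_root n_gt0 rn1 _ sz_r); last by exists z.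
by rewrite -separable_prod_XsubC -Dp separable_Xn_sub_1 // pnatr_eq0 -lt0n.
Qed.

Lemma sum_root_expr (n m : nat) (w : Cplx R) : n.-primitive_root w ->
  ~~ (n %| m)%N -> \sum_(i < n) w ^+ (i * m) = 0.
Proof.
move=> pw nm.
have wm1 : w ^+ m - 1 != 0 by rewrite subr_eq0 -(prim_order_dvd pw).
apply: (mulfI wm1); rewrite mulr0.
rewrite (eq_bigr (fun i : 'I_n => (w ^+ m) ^+ i)); last first.
  by move=> i _; rewrite mulnC exprM.
by rewrite -subrX1 -exprM mulnC exprM (prim_expr_order pw) expr1n subrr.
Qed.

Lemma has_jet3_divX g x k : x != 0 -> has_jet3 g x ->
  has_jet3 (fun y => g y / y ^+ k) x.
Proof.
move=> x0 Hg; elim: k => [|k IH].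
  by rewrite (_ : (fun _ => _) = g) //; apply/funext => y; rewrite expr0 divr1.
rewrite (_ : (fun _ => _) = (fun y => g y / y ^+ k / y)); first exact: has_jet3_div.
by apply/funext => y; rewrite exprSr invfM mulrA.
Qed.

(** The average of [w ^+ i * g (w ^+ i * x)] over the powers of a primitive
    [k.+1]-th root of unity [w] is bounded by [M] on the circle, has the same
    coefficient of order [k] as [g], and no coefficient of lower order. Hence
    its quotient by [x ^+ k] extends to [0] with value [c k], and the maximum
    principle applies to the extension. The averaging is what makes the
    constant equal to one: dividing [g] itself, after the removal of its
    Taylor polynomial, would lose a factor exponential in [k]. *)
Lemma cauchy_inequality g (r M : R) k c : 0 < r ->
  (forall x, modulus x <= r -> has_jet3 g x) -> jet g 0 c (k + 3) ->
  (forall x, modulus x = r -> modulus (g x) <= M) ->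
  modulus (c k) <= M / r ^+ k.
Proof.
move=> r0 Hg Hc HM.
have [w pw] := primitive_root_exists (ltn0Sn k).
have w1 : modulus w = 1.
  apply/eqP; rewrite -(@pexpr_eq1 _ _ k.+1) ?modulus_ge0 //.
  by rewrite -modulusX (prim_expr_order pw) modulus1.
have wX i : modulus (w ^+ i) = 1 by rewrite modulusX w1 expr1n.
pose N : Cplx R := k.+1%:R.
have N0 : N != 0 by rewrite pnatr_eq0.
(* As [w ^+ k.+1 = 1], the weight [w ^- (i * k)] that selects the
   coefficient of order [k] is [w ^+ i]. *)
pose H x := \sum_(i < k.+1) (N^-1 * w ^+ i) * g (w ^+ i * x).
pose C m := \sum_(i < k.+1) (N^-1 * w ^+ i) * (c m * (w ^+ i) ^+ m).
have CE m : C m = N^-1 * c m * \sum_(i < k.+1) w ^+ (i * m.+1).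
  rewrite mulr_sumr; apply: eq_bigr => i _.
  by rewrite mulnS exprD exprM; ring.
have C0 m : (m < k)%N -> C m = 0.
  by move=> mk; rewrite CE (sum_root_expr pw) ?mulr0 // gtnNdvd.
have Ck : C k = c k.
  rewrite CE (eq_bigr (fun=> 1)); last first.
    by move=> i _; rewrite mulnC exprM (prim_expr_order pw) expr1n.
  by rewrite sumr_const card_ord -/N mulrAC mulVf ?mul1r.
have jH : jet H 0 C (k + 3).
  apply: (@jet_sum _ _ (fun i => N^-1 * w ^+ i) (fun i y => g (w ^+ i * y)) 0
    (fun i m => c m * (w ^+ i) ^+ m)) => i.
  by apply: jet_rot; rewrite ?mulr0.
have HH x : modulus x <= r -> has_jet3 H x.
  move=> xr.
  have /choice[cs Hcs] : forall i, exists cs, jet g (w ^+ i * x) cs 3.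
    by move=> i; apply: Hg; rewrite modulusM wX mul1r.
  exists (fun m => \sum_(i < k.+1) (N^-1 * w ^+ i) * (cs i m * (w ^+ i) ^+ m)).
  apply: (@jet_sum _ _ (fun i => N^-1 * w ^+ i) (fun i y => g (w ^+ i * y)) x
    (fun i m => cs i m * (w ^+ i) ^+ m)) => i.
  exact: jet_rot.
pose q x := if x == 0 then c k else H x / x ^+ k.
have -> : c k = q 0 by rewrite /q eqxx.
apply: (maximum_principle r0) => x xr; last first.
  have x0 : x != 0 by apply: contra_eq_neq xr => ->; rewrite modulus0 lt_eqF.
  rewrite /q (negbTE x0) modulusM modulusV modulusX xr ler_wpM2r //.
    by rewrite invr_ge0 exprn_ge0 // ltW.
  rewrite /H (le_trans (ler_modulus_sum _ _ _)) //.
  have -> : M = \sum_(i < k.+1) (k.+1%:R^-1 * M).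
    by rewrite sumr_const card_ord -mulrnAl -mulr_natl divff ?mul1r // pnatr_eq0.
  apply: ler_sum => i _; rewrite !modulusM wX mulr1 modulusV modulus_nat.
  by rewrite ler_wpM2l ?invr_ge0 // HM // modulusM wX mul1r.
have [->|x0] := eqVneq x 0; last first.
  have [cs Hcs] := has_jet3_divX k x0 (HH x xr); exists cs.
  have mx : 0 < modulus x by apply: modulus_gt0.
  apply: jet_local Hcs; first by apply: (_ : 0 < modulus x / 2); rewrite divr_gt0.
  move=> h hx; rewrite /q ifF //; apply/negbTE; rewrite addrC addr_eq0.
  apply: contraTneq hx => ->; rewrite modulusN -ltNge; lra.
exists (fun m => C (k + m)%N).
have [d [A [d0 A0 HA]]] := jet_bound jH.
exists d, A; split=> // h hd; rewrite add0r.
have [->|h0] := eqVneq h 0.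
  rewrite (jet3_sum (fun i => C (k + i)%N)) /q eqxx !addn0 Ck.
  rewrite !expr0n /= !mulr0 !addr0 subrr modulus0.
  by rewrite mulr_ge0 // exprn_ge0 ?modulus_ge0.
have mh : 0 < modulus h by apply: modulus_gt0.
have := HA h hd; rewrite add0r big_split_ord /= big1 ?add0r; last first.
  by move=> i _; rewrite C0 ?mul0r //= ltn_ord.
have hk0 : h ^+ k != 0 by rewrite expf_neq0.
rewrite /q (negbTE h0).
have -> : H h - \sum_(i < 3) C (k + i)%N * h ^+ (k + i) =
    h ^+ k * (H h / h ^+ k - \sum_(i < 3) C (k + i)%N * h ^+ i).
  rewrite mulrBr mulrCA divff // mulr1 mulr_sumr; congr (_ - _).
  by apply: eq_bigr => i _; rewrite exprD mulrCA.
rewrite modulusM modulusX exprD mulrCA ler_pM2l ?exprn_gt0 //.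
Qed.

End Cauchy.

(** * Cauchy's inequality on polydiscs *)

Section Polydisc.
Variables (R : realType) (n : nat).
Implicit Types (z : 'rV[Cplx R]_n) (a : mindex n -> Cplx R) (j : 'I_n).
Implicit Types (F G : 'rV[Cplx R]_n -> Cplx R) (K : mindex n).

Definition axis_index j k : mindex n := [ffun i => if i == j then k else 0]%N.

Definition slice F z j (x : Cplx R) := F (z + x *: delta_mx ord0 j).

Lemma slice_shift F z j x h : slice F z j (x + h) =
  slice F (z + x *: delta_mx ord0 j) j h.
Proof. by rewrite /slice scalerDl addrA. Qed.

Lemma axis_index_inj j : injective (axis_index j).
Proof. by move=> k l /ffunP /(_ j); rewrite !ffunE eqxx. Qed.

(** Along the [j]-th coordinate axis through the centre, only the powers of
    the [j]-th variable survive; the tail of order at least [m] is dominated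
    term by term by [(modulus h / d) ^+ m] times the series at radius [d]. *)
Lemma slice_jet z (e : R) a G j m : 0 < e -> expansion z e a G ->
  jet (slice G z j) 0 (fun k => a (axis_index j k)) m.
Proof.
move=> e0 [Ha HG]; pose d := e / 2.
have d0 : 0 < d by rewrite divr_gt0.
have de : d < e by rewrite /d; lra.
have [|M HM] := Ha (fun=> d); first by move=> _; rewrite (ltW d0).
exists d, (M / d ^+ m); split=> // h hd; rewrite add0r.
pose x : 'I_n -> Cplx R := set_coord (fun=> 0) j h.
have Hh : has_sum (fun K => a K * mpow x K) (slice G z j h).
  have := HG (z + h *: delta_mx ord0 j).
  have -> : (fun i => (z + h *: delta_mx ord0 j) ord0 i - z ord0 i) = x.
    by apply/funext => i; rewrite coord_shift /x /set_coord addrC addKr.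
  apply=> i; rewrite coord_shift addrC addKr; case: ifP => _.
    exact: le_lt_trans hd de.
  by rewrite modulus0.
pose t := [seq axis_index j k | k <- iota 0 m].
pose b K := if K \in t then a K * mpow x K else 0.
have xm k : mpow x (axis_index j k) = h ^+ k.
  rewrite mpow_set_coord ffunE eqxx /mpow_but big1 ?mulr1 // => i /negbTE ij.
  by rewrite ffunE ij expr0.
have Hb : has_sum b (\sum_(k < m) a (axis_index j k) * h ^+ k).
  have -> : \sum_(k < m) a (axis_index j k) * h ^+ k = \sum_(K <- t) b K.
    rewrite [RHS](_ : _ = \sum_(K <- t) a K * mpow x K); last first.
      by rewrite !big_seq; apply: eq_bigr => K Kt; rewrite /b Kt.
    rewrite big_map -val_enum_ord big_map big_enum /=.
    by apply: eq_bigr => k _; rewrite xm.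
  apply: has_sum_fin; first by rewrite map_inj_uniq ?iota_uniq //; exact: axis_index_inj.
  by move=> K /negbTE Kt; rewrite /b Kt.
have := has_sum_lin (-1) Hh Hb; rewrite mulN1r.
apply: (has_sum_le (s0 := [::])) => s us _.
rewrite (le_trans (ler_modulus_sum _ _ _)) //.
have := HM s us => /(ler_wpM2l (exprn_ge0 m (divr_ge0 (modulus_ge0 h) (ltW d0)))).
rewrite (_ : _ * M = M / d ^+ m * modulus h ^+ m); last first.
  by rewrite expr_div_n; ring.
apply: le_trans; rewrite mulr_sumr; apply: ler_sum => K _.
have rhs0 : 0 <= (modulus h / d) ^+ m * (modulus (a K) * mpow (fun=> d) K).
  apply: mulr_ge0; first by rewrite exprn_ge0 // divr_ge0 ?modulus_ge0 ?ltW.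
  by rewrite mulr_ge0 ?modulus_ge0 // mpow_ge0 // => _; rewrite ltW.
rewrite /b; case: (boolP (K \in t)) => Kt; first by rewrite mulN1r subrr modulus0.
rewrite mulr0 addr0.
have [Km|] := eqVneq K (axis_index j (K j)); last first.
  move=> Km; have [i ij Ki] : exists2 i, i != j & K i != 0%N.
    apply/exists_inP; apply: contraNT Km => /exists_inPn Km.
    apply/eqP/ffunP => i; rewrite ffunE; case: eqVneq => [->//|ij].
    by apply/eqP; have := Km i ij; rewrite negbK.
  by rewrite (mpowE _ i) /x /set_coord (negbTE ij) expr0n (negbTE Ki) mul0r mulr0 modulus0.
have mK : (m <= K j)%N.
  rewrite leqNgt; apply: contra Kt => mK; rewrite Km map_f // mem_iota.
  by rewrite add0n.
rewrite modulusM modulus_mpow Km.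
have -> : mpow (fun i => modulus (x i)) (axis_index j (K j)) = modulus h ^+ K j.
  by rewrite -modulus_mpow xm modulusX.
have -> : mpow (fun=> d) (axis_index j (K j)) = d ^+ K j.
  rewrite (mpowE _ j) ffunE eqxx /mpow_but big1 ?mulr1 // => i /negbTE ij.
  by rewrite ffunE ij expr0.
rewrite mulrCA ler_wpM2l ?modulus_ge0 //.
have -> : modulus h ^+ K j = (modulus h / d) ^+ K j * d ^+ K j.
  by rewrite -exprMn divfK // gt_eqF.
rewrite ler_wpM2r ?exprn_ge0 ?(ltW d0) //.
apply: ler_wiXn2l => //; first by rewrite divr_ge0 ?modulus_ge0 ?ltW.
by rewrite ler_pdivrMr // mul1r.
Qed.

(** Multiplying by [(K j)`!] removes the quotient of factorials produced by
    the repeated shift. *)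
Lemma iter_dshift j a k K : (K j)`!%:R * iter k (@dshift R n j) a K =
  (K j + k)`!%:R * a [ffun i => K i + (if i == j then k else 0)]%N.
Proof.
elim: k K => [|k IH] K /=.
  rewrite addn0; congr (_ * a _); apply/ffunP => i; rewrite ffunE.
  by case: ifP; rewrite addn0.
rewrite /dshift mulrA -natrM mulnC -factS.
have := IH (incr K j); rewrite incrE eqxx addn1 => ->.
rewrite addSnnS; congr (_ * a _); apply/ffunP => i; rewrite !ffunE.
by case: (i == j); rewrite ?addn0 ?addn1 ?addSnnS.
Qed.

Lemma iter_dshift0 j a k :
  iter k (@dshift R n j) a [ffun=> 0%N] = k`!%:R * a (axis_index j k).
Proof.
have := iter_dshift j a k [ffun=> 0%N]; rewrite ffunE fact0 mul1r add0n => ->.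
by congr (_ * a _); apply/ffunP => i; rewrite !ffunE add0n.
Qed.

Variables (D : set 'rV[Cplx R]_n) (F : 'rV[Cplx R]_n -> Cplx R).
Hypothesis aF : analytic_on D F.

(** The one-variable inequality on the slice through [z]; at every point of
    the disc the slice has a Taylor expansion because [dword w F] has a power series
    expansion there. *)
Lemma cauchy_partial w z j k (r M : R) : 0 < r ->
  (forall x : Cplx R, modulus x <= r -> D (z + x *: delta_mx ord0 j)) ->
  (forall x : Cplx R, modulus x <= r ->
     modulus (dword w F (z + x *: delta_mx ord0 j)) <= M) ->
  modulus (iter k (partial j) (dword w F) z) <= k`!%:R / r ^+ k * M.
Proof.
move=> r0 HD HM.
have exp x : modulus x <= r -> exists (e : R) a, 0 < e /\
    expansion (z + x *: delta_mx ord0 j) e a (dword w F).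
  move=> /HD/(analytic_expansion aF)[e [a [e0 He]]].
  by exists e, (foldr (@dshift R n) a w); split=> //; exact: expansion_dword.
have [|e [a [e0 He]]] := exp 0; first by rewrite modulus0 ltW.
rewrite scale0r addr0 in He.
have -> : iter k (partial j) (dword w F) z = k`!%:R * a (axis_index j k).
  rewrite -iter_dshift0; have := expansion_center e0 (expansion_dword (nseq k j) He).
  by rewrite /dword !foldr_nseq.
rewrite modulusM modulus_nat -mulrA ler_wpM2l // mulrC.
apply: (@cauchy_inequality _ (slice (dword w F) z j) r M k
  (fun k => a (axis_index j k))) => //.
- move=> x /exp[e' [a' [e'0 He']]]; exists (fun k => a' (axis_index j k)).
  have [d [C [d0 H]]] := slice_jet j 3 e'0 He'; exists d, C; split=> // h hd.
  by rewrite slice_shift -[h in slice _ _ _ h]add0r H.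
- exact: slice_jet He.
- by move=> x xr; apply: HM; rewrite xr.
Qed.

(** The inequality is iterated over the coordinates, outermost derivative
    first: after the coordinates of a prefix of the word have been used,
    those that remain still have the value they have at [z0], so that one
    stays in the polydisc. *)
Lemma cauchy_mderiv z0 (r : 'I_n -> R) (M : R) K : (forall j, 0 < r j) ->
  polydisc z0 r `<=` D -> (forall z, polydisc z0 r z -> modulus (F z) <= M) ->
  modulus (mderiv K F z0) <= (mfact K)%:R / mpow r K * M.
Proof.
move=> r0 sub HM.
suff main s : uniq s -> forall z, polydisc z0 r z ->
    (forall j, j \in s -> z ord0 j = z0 ord0 j) ->
    modulus (foldr (fun j G => iter (K j) (partial j) G) F s z) <=
    \prod_(j <- s) ((K j)`!%:R / r j ^+ K j) * M.
  have := main _ (enum_uniq 'I_n) z0; rewrite /mderiv big_enum /=.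
  rewrite big_split /= prodfV natr_prod; apply=> // j.
  by rewrite subrr modulus0 ltW.
elim: s => [|j s IH] /=; first by move=> _ z /HM; rewrite big_nil mul1r.
move=> /andP[js us] z zP zs; rewrite big_cons -mulrA foldr_partial_dword.
have inP x : modulus x <= r j -> polydisc z0 r (z + x *: delta_mx ord0 j).
  move=> xr i; rewrite coord_shift; case: (eqVneq i j) => [->|_]; last first.
    by rewrite addr0; apply: zP.
  by rewrite zs ?mem_head // addrC addKr.
apply: cauchy_partial => // x xr; first exact/sub/inP.
rewrite -foldr_partial_dword; apply: IH => //; first exact: inP.
move=> i si; rewrite coord_shift ifF ?addr0 ?zs ?in_cons ?si ?orbT //.
by apply: contraNF js => /eqP <-.
Qed.

End Polydisc.

(** * A Gronwall inequality for maxima of moduli *)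

Section Gronwall.
Variable R : realType.

(** The function [B] grows strictly faster than the growth rate of [phi]
    allows, both by its rate [A + 1] and by its initial value. Hence the set
    of times up to which [phi] stays below [B] is closed and open in the unit
    interval, and [e] is arbitrary. The hypothesis is a pointwise growth
    bound instead of a derivative because it is applied to a maximum, which
    is not differentiable. *)
Lemma gronwall (phi : R -> R) (A : R) : 0 <= A ->
  (forall t, 0 <= t <= 1 -> 0 <= phi t) ->
  (forall t e, 0 <= t <= 1 -> 0 < e -> exists d, 0 < d /\
     forall s, 0 <= s <= 1 -> `|s - t| <= d ->
       `|phi s - phi t| <= (A * phi t + e) * `|s - t|) ->
  phi 1 <= phi 0 * expR (A + 1).
Proof.
move=> A0 phi0 H.
suff main e : 0 < e -> phi 1 <= (phi 0 + e) * expR (A + 1).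
  apply/ler_addgt0Pl => e e0.
  have := main (e / expR (A + 1)); rewrite divr_gt0 ?expR_gt0 // mulrDl.
  by rewrite divfK ?gt_eqF ?expR_gt0 // addrC; exact.
move=> e0.
pose B t := (phi 0 + e) * expR ((A + 1) * t).
have p00 : 0 <= phi 0 by apply: phi0; rewrite lexx ler01.
have pe0 : 0 < phi 0 + e by rewrite ltr_wpDl.
have Bgt0 t : 0 < B t by rewrite mulr_gt0 ?expR_gt0.
have Bmono s t : s <= t -> B s <= B t.
  move=> st; rewrite ler_wpM2l ?(ltW pe0) // ler_expR ler_wpM2l //.
  by rewrite addr_ge0.
have Bstep s t : t <= s -> B t * (1 + (A + 1) * (s - t)) <= B s.
  move=> ts; have -> : B s = B t * expR ((A + 1) * (s - t)).
    by rewrite /B -mulrA -expRD; congr (_ * expR _); ring.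
  by rewrite ler_wpM2l ?(ltW (Bgt0 _)) // expR_ge1Dx.
pose S := [set t : R | 0 <= t <= 1 /\ forall s, 0 <= s <= t -> phi s <= B s].
have S0 : S 0.
  split; first by rewrite lexx ler01.
  move=> s; rewrite -eq_le => /eqP <-; rewrite /B mulr0 expR0 mulr1 lerDl ltW //.
have supS : has_sup S.
  by split; [exists 0|exists 1 => t [/andP[]]].
pose t0 := sup S.
have t00 : 0 <= t0 by apply: sup_upper_bound.
have t01 : t0 <= 1 by apply: ge_sup => [|t [/andP[]//]]; exists 0.
have t0I : 0 <= t0 <= 1 by rewrite t00.
have below s : 0 <= s < t0 -> phi s <= B s.
  move=> /andP[s0 st]; have [|u [uI Hu] us] := @sup_adherent _ S (t0 - s) _ supS.
    by rewrite subr_gt0.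
  by apply: Hu; rewrite s0 ltW //; move: us; rewrite -/t0; lra.
have at0 : phi t0 <= B t0.
  rewrite leNgt; apply/negP => Bt.
  have [t0E|t0N] := eqVneq t0 0; first by move: Bt; rewrite t0E ltNge S0.2 ?lexx.
  have t0pos : 0 < t0 by rewrite lt_neqAle eq_sym t0N.
  have [d [d0 Hd]] := H t0 1 t0I ltr01.
  (* If [phi] exceeded [B] at [t0], it would still exceed [B t0] at distance
     [u] to the left of [t0]. *)
  pose c := A * phi t0 + 1.
  have c0 : 0 < c by rewrite /c ltr_wpDl // mulr_ge0 // phi0.
  pose u := Num.min (Num.min d t0) ((phi t0 - B t0) / c / 2).
  have u0 : 0 < u by rewrite !lt_min d0 t0pos !divr_gt0 ?subr_gt0.
  have [ud ut uc] : [/\ u <= d, u <= t0 & c * u < phi t0 - B t0].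
    split; [by rewrite !ge_min lexx|by rewrite !ge_min lexx orbT|].
    have : u <= (phi t0 - B t0) / c / 2 by rewrite ge_min lexx orbT.
    rewrite ler_pdivlMr // ler_pdivlMr // => uc.
    have : 0 < c * u by rewrite mulr_gt0.
    by clear -uc; lra.
  have sI : 0 <= t0 - u <= 1 by apply/andP; split; clear -ut u0 t01; lra.
  have nu : `|t0 - u - t0| = u by rewrite addrAC subrr sub0r normrN gtr0_norm.
  have := Hd (t0 - u) sI; rewrite nu => /(_ ud).
  rewrite -/c ler_norml => /andP[lo _].
  have b1 : phi (t0 - u) <= B (t0 - u).
    by apply: below; apply/andP; split; clear -ut u0; lra.
  have b2 : B (t0 - u) <= B t0 by apply: Bmono; clear -u0; lra.
  by clear -lo b1 b2 uc; lra.
have t0E : t0 = 1.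
  apply/eqP; rewrite eq_le t01 leNgt; apply/negP => t1.
  have [d [d0 Hd]] := H t0 (B t0) t0I (Bgt0 _).
  pose u := Num.min d (1 - t0).
  have u0 : 0 < u by rewrite lt_min d0 subr_gt0.
  have [ud u1] : u <= d /\ u <= 1 - t0 by rewrite !ge_min !lexx orbT.
  suff : S (t0 + u).
    move=> /(sup_upper_bound supS); rewrite -/t0; clear -u0; lra.
  split; first by apply/andP; split; clear -t00 u0 u1; lra.
  move=> s /andP[s0 su]; have [st|ts] := ltP s t0; first by rewrite below ?s0.
  apply: le_trans (Bstep s t0 ts).
  have nst : `|s - t0| = s - t0 by rewrite ger0_norm // subr_ge0.
  have sI : 0 <= s <= 1 by apply/andP; split=> //; clear -su u1; lra.
  have := Hd s sI; rewrite nst ler_norml.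
  have -> : s - t0 <= d by clear -su ud; lra.
  move=> /(_ isT) /andP[_ hi].
  have st0 : 0 <= s - t0 by rewrite subr_ge0.
  have := ler_wpM2r st0 (ler_wpM2l A0 at0).
  by move: hi at0; clear; rewrite !mulrDl !mulrDr !mul1r !mulr1; lra.
by have := at0; rewrite t0E /B mulr1.
Qed.

End Gronwall.

(** * Growth of the weighted derivatives on a polydisc *)

Section WeightedMax.
Variables (R : realType) (n : nat).
Implicit Types (z : 'rV[Cplx R]_n) (i j : 'I_n) (K : mindex n) (wt : 'I_n -> R).
Implicit Types (F : 'rV[Cplx R]_n -> Cplx R) (p : nat).

(** The normalised derivative for weights that do not move with the point. *)
Definition wquot wt F K z : R := modulus (mderiv K F z) / mpow wt K.

Definition wmax wt F p z : R :=
  \big[Num.max/0]_(K : {ffun 'I_n -> 'I_p.+1} | (mdeg (mval K) <= p)%N)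
    wquot wt F (mval K) z.

Lemma mval_surj K p : (mdeg K <= p)%N ->
  exists K' : {ffun 'I_n -> 'I_p.+1}, mval K' = K.
Proof.
move=> Kp; have H j : (K j < p.+1)%N.
  by rewrite ltnS (leq_trans _ Kp) // /mdeg (bigD1 j) //= leq_addr.
by exists [ffun j => Ordinal (H j)]; apply/ffunP => j; rewrite !ffunE.
Qed.

Lemma wmax_ge0 wt F p z : 0 <= wmax wt F p z.
Proof. exact: bigmax_ge_id. Qed.

Lemma wquot_le_wmax wt F p K z : (mdeg K <= p)%N ->
  wquot wt F K z <= wmax wt F p z.
Proof.
move=> Kp; have [K' E] := mval_surj Kp; rewrite -E in Kp *.
by rewrite /wmax; apply: (bigmax_sup K').
Qed.

Lemma wmax_le wt F p z c : 0 <= c ->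
  (forall K, (mdeg K <= p)%N -> wquot wt F K z <= c) -> wmax wt F p z <= c.
Proof. by move=> c0 H; apply: bigmax_le => // K /H. Qed.

Lemma mpow_gt0 wt K : (forall j, 0 < wt j) -> 0 < mpow wt K.
Proof. by move=> w0; apply: prodr_gt0 => j _; rewrite exprn_gt0. Qed.

Lemma mpow_incr wt K i : mpow wt (incr K i) = wt i * mpow wt K.
Proof. by rewrite !(mpowE _ i) mpow_but_incr incrE eqxx addn1 exprS mulrA. Qed.

Lemma mdeg_incr K i : mdeg (incr K i) = (mdeg K).+1.
Proof.
rewrite /mdeg (eq_bigr (fun j => K j + (j == i))%N); last by move=> j _; rewrite ffunE.
rewrite big_split /= [X in (_ + X)%N](bigD1 i) //= eqxx [X in (_ + (_ + X))%N]big1.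
  by rewrite addn0 addn1.
by move=> j /negbTE ->.
Qed.

(** The maximum is 1-Lipschitz for the uniform distance, so that a growth
    bound common to finitely many functions holds for their maximum. *)
Lemma bigmax_dist (I : finType) (P : pred I) (f g : I -> R) (c : R) : 0 <= c ->
  (forall k, P k -> `|f k - g k| <= c) ->
  `|\big[Num.max/0]_(k | P k) f k - \big[Num.max/0]_(k | P k) g k| <= c.
Proof.
move=> c0 H.
have one_sided (u v : I -> R) : (forall k, P k -> `|u k - v k| <= c) ->
    \big[Num.max/0]_(k | P k) u k <= \big[Num.max/0]_(k | P k) v k + c.
  move=> uv; apply: bigmax_le => [|k Pk].
    by rewrite addr_ge0 // bigmax_ge_id.
  have := uv k Pk; have := le_bigmax_cond 0 v Pk.
  by rewrite ler_norml => vi /andP[_ ?]; lra.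
have H1 := one_sided f g H.
have H2 : \big[Num.max/0]_(k | P k) g k <= \big[Num.max/0]_(k | P k) f k + c.
  by apply: one_sided => k Pk; rewrite distrC H.
by rewrite ler_norml; apply/andP; split; lra.
Qed.

Variables (D : set 'rV[Cplx R]_n) (F : 'rV[Cplx R]_n -> Cplx R).
Hypothesis aF : analytic_on D F.
Variables (wt : 'I_n -> R) (p : nat) (rho A : R).
Hypotheses (wt0 : forall j, 0 < wt j) (rho0 : 0 <= rho) (A0 : 0 <= A).

Definition ray z i (u : Cplx R) (t : R) := z + (t%:C%C * u) *: delta_mx ord0 i.

Lemma ray_shift z i u s t :
  ray z i u s = ray z i u t + ((s - t)%:C%C * u) *: delta_mx ord0 i.
Proof.
rewrite /ray -addrA -scalerDl; congr (_ + _ *: _).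
by rewrite -mulrDl -rmorphD /= addrC subrK.
Qed.

(** The rate of growth of [wquot wt F K] in the direction [i] is [modulus u *
    wt i] times [wquot wt F (incr K i)]: the extra factor [wt i] of the
    weight of [incr K i] compensates the length of the segment. *)
Lemma wquot_ray K z i u t (e : R) : D (ray z i u t) -> 0 < e ->
  modulus u * wt i <= rho ->
  wquot wt F (incr K i) (ray z i u t) <= A * wmax wt F p (ray z i u t) ->
  exists d, 0 < d /\ forall s, `|s - t| <= d ->
    `|wquot wt F K (ray z i u s) - wquot wt F K (ray z i u t)| <=
    (rho * A * wmax wt F p (ray z i u t) + e) * `|s - t|.
Proof.
move=> Dx e0 ur HA; have [d1 [C [d10 H]]] := mderiv_deriv aF K i Dx.
have W0 := mpow_gt0 K wt0; set W := mpow wt K in W0.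
set x := ray z i u t in Dx HA H *; set phi := wmax _ _ _ x in HA *.
have u0 := modulus_ge0 u.
pose a := modulus u + 1; have a0 : 0 < a by rewrite ltr_wpDl.
pose b := `|C| * modulus u ^+ 2 + 1.
have b0 : 0 < b by rewrite ltr_wpDl // mulr_ge0 ?exprn_ge0.
(* The second bound makes the quadratic remainder of [F^(K)] at most
   [e * W * `|s - t|]. *)
exists (Num.min (d1 / a) (e * W / b)); split.
  by rewrite lt_min !divr_gt0 // mulr_gt0.
move=> s; rewrite le_min !ler_pdivlMr // => /andP[sa sb].
pose h : Cplx R := (s - t)%:C%C * u.
have mh : modulus h = `|s - t| * modulus u by rewrite modulusM modulus_real.
have hd : modulus h <= d1.
  rewrite mh; apply: le_trans sa; rewrite ler_wpM2l // /a; lra.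
have {}H := H h hd; rewrite /wquot -mulrBl normrM [`|W^-1|]gtr0_norm ?invr_gt0 //.
rewrite ler_pdivrMr // (le_trans (ler_dist_modulus _ _)) //.
rewrite (ray_shift _ _ _ s t) -/x -/h.
set G' := mderiv (incr K i) F x in H.
set G1 := mderiv K F _; set G := mderiv K F x.
have H1 : modulus (G1 - G) <= modulus h * modulus G' + C * modulus h ^+ 2.
  rewrite -modulusM -(subrK (h * G') (G1 - G)).
  by rewrite (le_trans (ler_modulusD _ _)) // addrC lerD2l.
apply: le_trans H1 _.
have G'E : modulus G' = wquot wt F (incr K i) x * wt i * W.
  by rewrite /wquot mpow_incr -/W; field; rewrite !gt_eqF.
have first : modulus h * modulus G' <= rho * A * phi * `|s - t| * W.
  rewrite mh G'E.
  rewrite (_ : _ * _ = (modulus u * wt i) * wquot wt F (incr K i) x * `|s - t| * W);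
    last by ring.
  rewrite ler_wpM2r ?(ltW W0) // ler_wpM2r // -[leRHS]mulrA; apply: ler_pM => //.
    by rewrite mulr_ge0 // ltW.
  by rewrite divr_ge0 ?modulus_ge0 // ltW // mpow_gt0.
have second : C * modulus h ^+ 2 <= e * `|s - t| * W.
  have : `|s - t| * (`|s - t| * b) <= `|s - t| * (e * W) by rewrite ler_wpM2l.
  have -> : e * `|s - t| * W = `|s - t| * (e * W) by ring.
  apply: le_trans; rewrite mh exprMn /b.
  have := ler_norm C; have := sqr_ge0 `|s - t|; rewrite expr2 => ss Cn.
  have cc : C * (`|s - t| * `|s - t| * modulus u ^+ 2) <=
      `|C| * (`|s - t| * `|s - t| * modulus u ^+ 2).
    by rewrite ler_wpM2r // mulr_ge0 // exprn_ge0.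
  apply: (le_trans cc); rewrite mulrDr mulr1 mulrDr.
  rewrite (_ : _ * (_ * _) = `|s - t| * (`|s - t| * (`|C| * modulus u ^+ 2))).
    by rewrite lerDl.
  by ring.
by rewrite mulrDl mulrDl lerD.
Qed.

Lemma wmax_ray z i u : modulus u * wt i <= rho ->
  (forall t, 0 <= t <= 1 -> D (ray z i u t) /\
    forall K, (mdeg K <= p)%N ->
      wquot wt F (incr K i) (ray z i u t) <= A * wmax wt F p (ray z i u t)) ->
  wmax wt F p (ray z i u 1) <= wmax wt F p (ray z i u 0) * expR (rho * A + 1).
Proof.
move=> ur H; apply: (gronwall (phi := fun t => wmax wt F p (ray z i u t))).
- by rewrite mulr_ge0.
- by move=> t _; exact: wmax_ge0.
move=> t e tI e0; have [Dx HA] := H t tI.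
have /choice[d Hd] : forall K : {ffun 'I_n -> 'I_p.+1}, exists d : R, 0 < d /\
    ((mdeg (mval K) <= p)%N -> forall s, `|s - t| <= d ->
    `|wquot wt F (mval K) (ray z i u s) - wquot wt F (mval K) (ray z i u t)| <=
    (rho * A * wmax wt F p (ray z i u t) + e) * `|s - t|).
  move=> K; case: (boolP (mdeg (mval K) <= p)%N) => Kp; last by exists 1.
  have [d [d0 Hd]] := wquot_ray Dx e0 ur (HA _ Kp).
  by exists d.
exists (\big[Num.min/1]_K d K); split.
  by apply/bigmin_gtP; split => // K _; have [] := Hd K.
move=> s _ /bigmin_geP[_ sd]; apply: bigmax_dist.
  rewrite mulr_ge0 // addr_ge0 ?(ltW e0) // mulr_ge0 ?wmax_ge0 //.
  by rewrite mulr_ge0.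
by move=> K Kp; have [_] := Hd K; apply=> //; exact: sd.
Qed.

(** A point of the polydisc is reached from the centre along [n] coordinate
    segments inside the polydisc; each of them multiplies the maximum by at
    most the Gronwall factor. *)
Lemma wmax_polydisc z0 :
  (forall z, polydisc z0 (fun j => rho / wt j) z -> D z /\
    forall K i, (mdeg K <= p)%N ->
      wquot wt F (incr K i) z <= A * wmax wt F p z) ->
  forall z, polydisc z0 (fun j => rho / wt j) z ->
    wmax wt F p z <= wmax wt F p z0 * expR (rho * A + 1) ^+ n.
Proof.
move=> H; pose E := expR (rho * A + 1).
have r0 j : 0 <= rho / wt j by rewrite divr_ge0 // ltW.
suff main m : (m <= n)%N -> forall z, polydisc z0 (fun j => rho / wt j) z ->
    (forall j : 'I_n, (m <= j)%N -> z ord0 j = z0 ord0 j) ->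
    wmax wt F p z <= wmax wt F p z0 * E ^+ m.
  by move=> z zP; apply: main => // j; rewrite leqNgt ltn_ord.
elim: m => [_ z _ zz|m IH mn z zP zz].
  by rewrite expr0 mulr1 (_ : z = z0) //; apply/rowP => j; rewrite zz.
pose i := Ordinal mn; pose u := z ord0 i - z0 ord0 i.
pose z' := z + (- u) *: delta_mx ord0 i.
have z'E j : z' ord0 j = if j == i then z0 ord0 i else z ord0 j.
  rewrite coord_shift; case: (eqVneq j i) => [->|_]; last by rewrite addr0.
  by rewrite /u opprB addrC subrK.
have rayP t : 0 <= t <= 1 -> polydisc z0 (fun j => rho / wt j) (ray z' i u t).
  move=> /andP[t0 t1] j; rewrite coord_shift z'E.
  case: (eqVneq j i) => [->|_]; last by rewrite addr0; apply: zP.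
  rewrite addrC addKr modulusM modulus_real ger0_norm //.
  by apply: le_trans (zP i); rewrite ler_piMl ?modulus_ge0.
have ray1 : ray z' i u 1 = z.
  by rewrite /ray /z' mul1r -addrA -scalerDl addNr scale0r addr0.
have ray0 : ray z' i u 0 = z' by rewrite /ray mul0r scale0r addr0.
have := @wmax_ray z' i u; rewrite ray1 ray0 => Hw.
apply: le_trans (Hw _ _) _.
- by have := zP i; rewrite ler_pdivlMr.
- by move=> t /rayP/H[Dt Ht]; split=> // K; exact: Ht.
rewrite exprSr mulrA -/E ler_wpM2r ?expR_ge0 //.
apply: IH => [|j|j mj]; first exact: ltnW.
  by have := rayP 0; rewrite ray0 lexx ler01 => /(_ isT j).
rewrite z'E; case: eqVneq => [->//|ji]; apply: zz.
by rewrite ltn_neqAle mj andbT; apply: contra_neq ji => mj'; apply/val_inj.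
Qed.

End WeightedMax.

(** * Geometry of the ball and comparison of weights *)

Section Geometry.
Variables (R : realType) (n : nat).
Implicit Types (a b : 'I_n -> R) (z : 'rV[Cplx R]_n).

Lemma enorm_ge0 a : 0 <= enorm a.
Proof. exact: sqrtr_ge0. Qed.

Lemma enorm_sqr a : enorm a ^+ 2 = \sum_j a j ^+ 2.
Proof. by rewrite sqr_sqrtr // sumr_ge0 // => j _; rewrite sqr_ge0. Qed.

Lemma cauchy_schwarz a b : \sum_j a j * b j <= enorm a * enorm b.
Proof.
have [A0|A0] := eqVneq (enorm a) 0.
  rewrite A0 mul0r big1 // => j _.
  have : \sum_j a j ^+ 2 == 0 by rewrite -enorm_sqr A0 expr0n.
  rewrite psumr_eq0 => [/allP/(_ j)|i _]; last exact: sqr_ge0.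
  by rewrite mem_index_enum sqrf_eq0 => /(_ isT)/eqP ->; rewrite mul0r.
have [B0|B0] := eqVneq (enorm b) 0.
  rewrite B0 mulr0 big1 // => j _.
  have : \sum_j b j ^+ 2 == 0 by rewrite -enorm_sqr B0 expr0n.
  rewrite psumr_eq0 => [/allP/(_ j)|i _]; last exact: sqr_ge0.
  by rewrite mem_index_enum sqrf_eq0 => /(_ isT)/eqP ->; rewrite mulr0.
have AB : 0 < enorm a * enorm b.
  by rewrite mulr_gt0 // lt_neqAle eq_sym ?A0 ?B0 enorm_ge0.
have : 0 <= \sum_j (a j * enorm b - b j * enorm a) ^+ 2.
  by apply: sumr_ge0 => j _; exact: sqr_ge0.
have -> : \sum_j (a j * enorm b - b j * enorm a) ^+ 2 =
    2 * (enorm a * enorm b) * (enorm a * enorm b - \sum_j a j * b j).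
  transitivity (enorm b ^+ 2 * (\sum_j a j ^+ 2) + enorm a ^+ 2 * (\sum_j b j ^+ 2)
      - 2 * (enorm a * enorm b) * \sum_j a j * b j).
    rewrite !mulr_sumr -big_split /= -sumrB; apply: eq_bigr => j _; ring.
  by rewrite -!enorm_sqr; ring.
by rewrite pmulr_rge0 ?subr_ge0 // mulr_gt0.
Qed.

Lemma ler_enormD a b : enorm (fun j => a j + b j) <= enorm a + enorm b.
Proof.
rewrite -(@ler_pXn2r _ 2) ?nnegrE ?addr_ge0 ?enorm_ge0 // enorm_sqr.
rewrite (_ : \sum_j _ = enorm a ^+ 2 + enorm b ^+ 2 + 2 * \sum_j a j * b j).
  by have := cauchy_schwarz a b; rewrite sqrrD mulr2n; lra.
rewrite !enorm_sqr mulr_sumr -!big_split /=; apply: eq_bigr => j _; ring.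
Qed.

Lemma ler_enorm a b : (forall j, 0 <= a j <= b j) -> enorm a <= enorm b.
Proof.
move=> H; apply: ler_wsqrtr; apply: ler_sum => j _; have /andP[a0 ab] := H j.
by rewrite lerXn2r ?nnegrE // (le_trans a0).
Qed.

(** The polyradius has Euclidean norm less than [rho * sqrt n * (1 - cenorm
    z0) / beta = 1 - cenorm z0]. *)
Lemma polydisc_sub_ball (beta rho : R) (wt : 'I_n -> R) z0 : (0 < n)%N ->
  0 < rho -> beta = rho * Num.sqrt n%:R -> cenorm z0 < 1 ->
  (forall j, beta / (1 - cenorm z0) < wt j) ->
  polydisc z0 (fun j => rho / wt j) `<=` unit_ball R n.
Proof.
move=> n0 rho0 bE z01 Hwt z zP; rewrite /unit_ball /=.
have s0 : 0 < Num.sqrt n%:R :> R by rewrite sqrtr_gt0 ltr0n.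
have b0 : 0 < beta by rewrite bE mulr_gt0.
pose d := 1 - cenorm z0; have d0 : 0 < d by rewrite subr_gt0.
have bd : 0 < beta / d by rewrite divr_gt0.
have H : enorm (fun j => modulus (z ord0 j - z0 ord0 j)) < d.
  rewrite -(@ltr_pXn2r _ 2) ?nnegrE ?enorm_ge0 ?(ltW d0) // enorm_sqr.
  have -> : d ^+ 2 = \sum_(j < n) (d / Num.sqrt n%:R) ^+ 2.
    rewrite sumr_const card_ord expr_div_n sqr_sqrtr ?ler0n // -[RHS]mulr_natr divfK //.
    by rewrite pnatr_eq0 -lt0n.
  apply: ltr_sum.
    by apply/hasP; exists (Ordinal n0); rewrite ?mem_index_enum.
  move=> j _; rewrite ltr_pXn2r ?nnegrE ?modulus_ge0 ?divr_ge0 ?(ltW d0) ?(ltW s0) //.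
  apply: le_lt_trans (zP j) _.
  have w0 : 0 < wt j by apply: lt_trans (Hwt j).
  rewrite ltr_pdivrMr // -[ltLHS](mulfVK (_ : d / Num.sqrt n%:R != 0));
    last by rewrite gt_eqF ?divr_gt0.
  rewrite mulrC ltr_pM2l ?divr_gt0 //; apply: le_lt_trans (Hwt j).
  by rewrite bE -/d invf_div mulrA.
have -> : (1 : R) = cenorm z0 + d by rewrite /d; ring.
rewrite -(ltrD2l (cenorm z0)) in H; apply: le_lt_trans H.
apply: le_trans (ler_enormD _ _); apply: ler_enorm => j; rewrite modulus_ge0 /=.
by rewrite -{1}(subrK (z0 ord0 j) (z ord0 j)) addrC ler_modulusD.
Qed.

Lemma mpow_const_mul (c : R) b (K : mindex n) :
  mpow (fun j => c * b j) K = c ^+ mdeg K * mpow b K.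
Proof.
rewrite /mpow (eq_bigr (fun j => c ^+ K j * b j ^+ K j)); last first.
  by move=> j _; rewrite exprMn.
by rewrite big_split /= -expr_sum.
Qed.

Lemma wquot_compare (a b : 'I_n -> R) (c : R) F (K : mindex n) z :
  (forall j, 0 < a j) -> (forall j, 0 < b j) -> (forall j, b j <= c * a j) ->
  wquot a F K z <= c ^+ mdeg K * wquot b F K z.
Proof.
move=> a0 b0 bc; rewrite /wquot mulrCA ler_wpM2l ?modulus_ge0 //.
rewrite -[leLHS]mul1r ler_pdivrMr ?mpow_gt0 // mulrAC -mpow_const_mul.
rewrite ler_pdivlMr ?mpow_gt0 // mul1r; apply: ler_prod => j _.
have bj0 := ltW (b0 j).
by rewrite exprn_ge0 //= lerXn2r ?nnegrE // (le_trans bj0).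
Qed.

Lemma leq_fact_mul k l : (k`! * l`! <= (k + l)`!)%N.
Proof.
by rewrite -(bin_fact (leq_addr l k)) addKn leq_pmull // bin_gt0 leq_addr.
Qed.

Lemma leq_mfact (K : mindex n) : (mfact K <= (mdeg K)`!)%N.
Proof.
rewrite /mfact /mdeg; elim/big_rec2: _ => [//|j k l _ H].
by apply: leq_trans (leq_fact_mul _ _); rewrite leq_mul2l H orbT.
Qed.

Lemma mfact_gt0 (K : mindex n) : (0 < mfact K)%N.
Proof. by rewrite prodn_gt0 // => j; exact: fact_gt0. Qed.

Lemma expr_unbounded (rho B : R) : 1 < rho -> exists N, B <= rho ^+ N.
Proof.
move=> r1; have d0 : 0 < rho - 1 by rewrite subr_gt0.
have bern N : 1 + N%:R * (rho - 1) <= rho ^+ N.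
  elim: N => [|N IH]; first by rewrite mul0r addr0 expr0.
  have := ler_wpM2l (ltW (lt_trans ltr01 r1)) IH; rewrite -exprS.
  apply: le_trans; rewrite -natr1.
  have := mulr_ge0 (ler0n R N) (sqr_ge0 (rho - 1)); rewrite expr2; nra.
exists (Num.bound (B / (rho - 1))); apply: le_trans (bern _).
have [B0|B0] := leP B 0.
  by apply: le_trans B0 _; rewrite addr_ge0 // mulr_ge0 // ltW.
have := archi_boundP (divr_ge0 (ltW B0) (ltW d0)).
rewrite ltr_pdivrMr // => /ltW H; lra.
Qed.

End Geometry.

(** * Bounded index *)

Section BoundedIndex.
Variables (R : realType) (n : nat).
Implicit Types (L : 'I_n -> 'rV[Cplx R]_n -> R) (z : 'rV[Cplx R]_n).
Implicit Types (F : 'rV[Cplx R]_n -> Cplx R) (K J : mindex n).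

(** What the class Q says of the weights on the polydiscs of radii [r / L],
    as a two-sided comparison with one constant. *)
Definition bounded_ratio L (r : 'I_n -> R) (c : R) := forall z0 z,
  unit_ball R n z0 -> polydisc z0 (fun j => r j / L j z0) z ->
  forall j, L j z <= c * L j z0 /\ L j z0 <= c * L j z.

Lemma classQ_bounded_ratio beta L (r : 'I_n -> R) : classQ beta L ->
  (forall j z, unit_ball R n z -> 0 < L j z) ->
  (forall j, 0 <= r j) -> enorm r <= beta ->
  exists c, 1 <= c /\ bounded_ratio L r c.
Proof.
move=> [_ _ _ Q] L0 r0 rb; have {}Q := Q r r0 rb.
have /choice[M HM] : forall j, exists M : R, 0 < M /\
    forall z0 z, unit_ball R n z0 -> polydisc z0 (fun i => r i / L i z0) z ->
      L j z <= M * L j z0 /\ L j z0 <= M * L j z.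
  move=> j; have [l1 _ l2] := Q j.
  have [u Hu] : exists u : R, (lambda2 L r j <= u%:E)%E.
    case: (lambda2 L r j) l2 => [v _|//|_]; last by exists 0; exact: leNye.
    by exists v.
  have [v [v0 Hv]] : exists v : R, 0 < v /\ (v%:E <= lambda1 L r j)%E.
    case: (lambda1 L r j) l1 => [v|_|//]; first by rewrite lte_fin => v0; exists v.
    by exists 1; split=> //; exact: leey.
  exists (`|u| + v^-1); split; first by rewrite ltr_wpDl ?invr_gt0.
  move=> z0 z z0B zP; have Lz0 := L0 j z0 z0B.
  have Lr : lratios L r j (L j z / L j z0)%:E by exists z0, z.
  have := le_trans (ereal_sup_ubound Lr) Hu; rewrite lee_fin ler_pdivrMr // => H1.
  have := le_trans Hv (ereal_inf_lbound Lr); rewrite lee_fin ler_pdivlMr // => H2.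
  have Lz : 0 < L j z by apply: lt_le_trans H2; rewrite mulr_gt0.
  split.
    apply: le_trans H1 _; rewrite ler_pM2r // (le_trans (ler_norm u)) // lerDl.
    by rewrite invr_ge0 ltW.
  rewrite mulrDl; have : L j z0 <= v^-1 * L j z by rewrite ler_pdivlMl.
  have := mulr_ge0 (normr_ge0 u) (ltW Lz); lra.
have S0 : 0 <= \sum_j M j by apply: sumr_ge0 => j _; have [/ltW] := HM j.
exists (1 + \sum_j M j); split; first by rewrite lerDl.
move=> z0 z z0B zP j; have [M0 H] := HM j; have [H1 H2] := H z0 z z0B zP.
have MS : M j <= 1 + \sum_j M j.
  rewrite (bigD1 j) //= addrCA lerDl addr_ge0 // sumr_ge0 // => i _.
  by have [/ltW] := HM i.
have Lz0 := L0 j z0 z0B.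
have Lz : 0 < L j z by rewrite -(pmulr_rgt0 _ M0) (lt_le_trans Lz0).
split; [apply: le_trans H1 _|apply: le_trans H2 _].
  by rewrite ler_wpM2r // ltW.
by rewrite ler_wpM2r // ltW.
Qed.

Lemma wquot_le_max_dquot_eq L F z m K : mdeg K = m ->
  wquot (fun j => L j z) F K z <= max_dquot_eq L F z m.
Proof.
move=> Km; have Km' : (mdeg K <= m)%N by rewrite Km.
have [K' E] := mval_surj Km'; rewrite -E in Km *.
by rewrite /max_dquot_eq; apply: (bigmax_sup K'); rewrite ?Km.
Qed.

Lemma index_sup L F z m K : (mdeg K <= m)%N ->
  modulus (mderiv K F z) / ((mfact K)%:R * mpow (fun j => L j z) K) <=
  \big[Num.max/0]_(K : {ffun 'I_n -> 'I_m.+1} | (mdeg (mval K) <= m)%N)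
    (modulus (mderiv (mval K) F z) /
      ((mfact (mval K))%:R * mpow (fun j => L j z) (mval K))).
Proof.
move=> Km; have [K' E] := mval_surj Km; rewrite -E in Km *.
by apply: (bigmax_sup K').
Qed.

(** The index inequality loses only factorials: [J!] is at most [(m+1)!], and
    dividing by [K!] decreases the maximum on the right. *)
Lemma bounded_Lindex_max_dquot L F m z : (forall j, 0 < L j z) ->
  (forall J, modulus (mderiv J F z) / ((mfact J)%:R * mpow (fun j => L j z) J) <=
    \big[Num.max/0]_(K : {ffun 'I_n -> 'I_m.+1} | (mdeg (mval K) <= m)%N)
      (modulus (mderiv (mval K) F z) /
        ((mfact (mval K))%:R * mpow (fun j => L j z) (mval K)))) ->
  max_dquot_eq L F z m.+1 <= (m.+1)`!%:R * max_dquot_le L F z m.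
Proof.
move=> L0 H; have M0 : 0 <= max_dquot_le L F z m by exact: bigmax_ge_id.
rewrite /max_dquot_eq; apply: bigmax_le => [|J /eqP Jm]; first by rewrite mulr_ge0.
have W0 := mpow_gt0 (mval J) L0.
have f0 : 0 < (mfact (mval J))%:R :> R by rewrite ltr0n mfact_gt0.
have := H (mval J); rewrite ler_pdivrMr ?mulr_gt0 // => HJ.
rewrite /dquot ler_pdivrMr //; apply: (le_trans HJ).
rewrite mulrA ler_pM2r // mulrC; apply: ler_pM => //.
- exact: bigmax_ge_id.
- by rewrite ler_nat; have := leq_mfact (mval J); rewrite Jm.
apply: bigmax_le => // K Km; apply: le_trans (wquot_le_wmax _ _ _ Km).
have WK := mpow_gt0 (mval K) L0.
rewrite /wquot ler_wpM2l ?modulus_ge0 // lef_pV2 ?posrE ?mulr_gt0 ?ltr0n ?mfact_gt0 //.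
by rewrite ler_peMl ?(ltW WK) // ler1n mfact_gt0.
Qed.

Section Converse.
Variables (L : 'I_n -> 'rV[Cplx R]_n -> R) (F : 'rV[Cplx R]_n -> Cplx R).
Variables (p : nat) (c rho q : R).
Hypotheses (aF : analytic_on (unit_ball R n) F) (c0 : 0 <= c) (q1 : 1 <= q).
Hypotheses (rho1 : 1 < rho) (Lq : bounded_ratio L (fun=> rho) q).
Hypothesis L0 : forall j z, unit_ball R n z -> 0 < L j z.
Hypothesis sub : forall z0, unit_ball R n z0 ->
  polydisc z0 (fun j => rho / L j z0) `<=` unit_ball R n.
Hypothesis HF : forall z, unit_ball R n z ->
  max_dquot_eq L F z p.+1 <= c * max_dquot_le L F z p.

Let A := 1 + q ^+ p.+1 * (c * q ^+ p).

Let A0 : 0 <= A.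
Proof. by rewrite addr_ge0 // !mulr_ge0 ?exprn_ge0 // (le_trans ler01). Qed.

(** For derivatives of order at most [p] there is nothing to do. For those of
    order [p.+1] the hypothesis at [z] applies, once the frozen weights have
    been exchanged for those at [z] and back, each exchange costing powers of
    [q]. *)
Lemma wquot_incr_le z0 z K i : unit_ball R n z0 ->
  polydisc z0 (fun j => rho / L j z0) z -> (mdeg K <= p)%N ->
  wquot (fun j => L j z0) F (incr K i) z <= A * wmax (fun j => L j z0) F p z.
Proof.
move=> z0B zP Kp; set wt := fun j => L j z0.
have W0 := wmax_ge0 wt F p z; have zB := sub z0B zP.
have q0 : 0 <= q := le_trans ler01 q1.
rewrite mulrDl mul1r; have [Kp'|] := ltnP (mdeg K) p.
  rewrite -[leLHS]addr0; apply: lerD; last by rewrite !mulr_ge0 ?exprn_ge0.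
  by apply: wquot_le_wmax; rewrite mdeg_incr.
move=> pK; have {pK}Kp : mdeg K = p by apply/eqP; rewrite eqn_leq Kp pK.
rewrite -[leLHS]add0r; apply: lerD => //.
have wt0 j : 0 < wt j by apply: L0.
have Lz0 j : 0 < L j z by apply: L0.
have wtL j : L j z <= q * wt j by have [] := Lq z0B zP j.
have Lwt j : wt j <= q * L j z by have [] := Lq z0B zP j.
apply: le_trans (wquot_compare F (incr K i) z wt0 Lz0 wtL) _.
rewrite mdeg_incr Kp -mulrA ler_wpM2l ?exprn_ge0 //.
apply: le_trans (wquot_le_max_dquot_eq L F z (_ : _ = p.+1)) _.
  by rewrite mdeg_incr Kp.
apply: le_trans (HF zB) _; rewrite -mulrA ler_wpM2l //.
apply: wmax_le => [|K' K'p]; first by rewrite mulr_ge0 ?exprn_ge0.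
apply: le_trans (wquot_compare F K' z Lz0 wt0 Lwt) _.
apply: ler_pM; rewrite ?exprn_ge0 ?ler_weXn2l ?wquot_le_wmax //.
by rewrite divr_ge0 ?modulus_ge0 // ltW // mpow_gt0.
Qed.

(** The hypothesis of [wmax_polydisc] is [wquot_incr_le], so that [F] is
    bounded on the polydisc by a multiple of the maximum at the centre;
    Cauchy's inequality on the same polydisc turns the radii [rho / L] into
    the gain [rho ^+ mdeg J]. *)
Lemma deriv_le_wmax z0 J : unit_ball R n z0 ->
  modulus (mderiv J F z0) / ((mfact J)%:R * mpow (fun j => L j z0) J) <=
  expR (rho * A + 1) ^+ n / rho ^+ mdeg J * wmax (fun j => L j z0) F p z0.
Proof.
move=> z0B; set wt := fun j => L j z0.
have wt0 j : 0 < wt j by apply: L0.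
have rho0 : 0 < rho := lt_trans ltr01 rho1.
have HP := @wmax_polydisc R n _ F aF wt p rho A wt0 (ltW rho0) A0 z0 _.
have r0 j : 0 < rho / wt j by rewrite divr_gt0.
have HM z : polydisc z0 (fun j => rho / wt j) z ->
    modulus (F z) <= wmax wt F p z0 * expR (rho * A + 1) ^+ n.
  move=> zP; apply: le_trans (HP _ z zP) => [|{zP}z zP]; last first.
    by split=> [|K i Kp]; [exact: (sub z0B)|exact: wquot_incr_le].
  pose K0 : mindex n := [ffun=> 0%N].
  have d0 : mdeg K0 = 0%N by rewrite /mdeg big1 // => j _; rewrite ffunE.
  have := @wquot_le_wmax R n wt F p K0 z; rewrite d0 => /(_ isT).
  rewrite /wquot /mpow big1 ?divr1; last by move=> j _; rewrite ffunE expr0.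
  congr (modulus _ <= _); rewrite mderiv_dword /word.
  suff -> : flatten [seq nseq (K0 j) j | j <- enum 'I_n] = [::] by [].
  by elim: (enum _) => [|j s IH] //=; rewrite ffunE.
have := cauchy_mderiv aF J r0 (sub z0B) HM.
have W0 := mpow_gt0 J wt0.
have f0 : 0 < (mfact J)%:R :> R by rewrite ltr0n mfact_gt0.
rewrite ler_pdivrMr ?mulr_gt0 //; congr (_ <= _).
have -> : mpow (fun j => rho / wt j) J = rho ^+ mdeg J / mpow wt J.
  rewrite mpow_const_mul; congr (_ * _); rewrite /mpow -prodfV.
  by apply: eq_bigr => j _; rewrite exprVn.
by field; rewrite expf_neq0 gt_eqF.
Qed.

Lemma wmax_le_index z m : unit_ball R n z -> (p <= m)%N ->
  wmax (fun j => L j z) F p z <= p`!%:R *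
  \big[Num.max/0]_(K : {ffun 'I_n -> 'I_m.+1} | (mdeg (mval K) <= m)%N)
    (modulus (mderiv (mval K) F z) /
      ((mfact (mval K))%:R * mpow (fun j => L j z) (mval K))).
Proof.
move=> zB pm; apply: wmax_le => [|K Kp].
  by rewrite mulr_ge0 // bigmax_ge_id.
have W0 := mpow_gt0 K (fun j => L0 j zB).
have f0 : 0 < (mfact K)%:R :> R by rewrite ltr0n mfact_gt0.
have -> : wquot (fun j => L j z) F K z = (mfact K)%:R *
    (modulus (mderiv K F z) / ((mfact K)%:R * mpow (fun j => L j z) K)).
  by rewrite /wquot; field; rewrite !gt_eqF.
apply: ler_pM; rewrite ?index_sup ?(leq_trans Kp) //.
- by rewrite divr_ge0 ?modulus_ge0 // mulr_ge0 // ltW.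
- by rewrite ler_nat (leq_trans (leq_mfact K)) // leq_fact.
Qed.

(** As [rho] exceeds 1, the gain in [deriv_le_wmax] beats the constants as
    soon as [mdeg J] is large, and smaller orders are part of the maximum. *)
Lemma max_dquot_bounded_Lindex : bounded_Lindex L F.
Proof.
pose E := expR (rho * A + 1) ^+ n.
have [N HN] := expr_unbounded (E * p`!%:R) rho1.
pose m := maxn p N; exists m => z zB J.
have [Jm|mJ] := leqP (mdeg J) m; first exact: index_sup.
apply: le_trans (deriv_le_wmax J zB) _.
have rho0 : 0 < rho := lt_trans ltr01 rho1.
have E0 : 0 <= E by rewrite exprn_ge0 // expR_ge0.
have rJ : 0 < rho ^+ mdeg J by rewrite exprn_gt0.
have small : E / rho ^+ mdeg J * p`!%:R <= 1.
  rewrite mulrAC ler_pdivrMr // mul1r (le_trans HN) // ler_weXn2l ?(ltW rho1) //.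
  by rewrite (leq_trans (leq_maxr p N)) // ltnW.
have := wmax_le_index zB (leq_maxl p N); rewrite -/m.
set I := \big[_/_]_(_ | _) _ => WI.
have I0 : 0 <= I by exact: bigmax_ge_id.
apply: le_trans (ler_wpM2l _ WI) _; first by rewrite divr_ge0 // ltW.
by rewrite mulrA ler_piMl.
Qed.

End Converse.

End BoundedIndex.

Theorem theorem9 (R : realType) (n : nat) (beta : R)
    (L : 'I_n -> 'rV[Cplx R]_n -> R) (F : 'rV[Cplx R]_n -> Cplx R)
    (n_gt0 : (0 < n)%N) (beta_gt : Num.sqrt n%:R < beta)
    (LQ : classQ beta L) (F_analytic : analytic_on (unit_ball R n) F) :
  bounded_Lindex L F <->
  exists (p : nat) (c : R), 0 <= c /\
    forall z, unit_ball R n z ->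
      max_dquot_eq L F z p.+1 <= c * max_dquot_le L F z p.
Proof.
have s0 : 0 < Num.sqrt n%:R :> R by rewrite sqrtr_gt0 ltr0n.
have b0 : 0 < beta by apply: lt_trans beta_gt.
have [_ _ Lbeta _] := LQ.
have L0 j z : unit_ball R n z -> 0 < L j z.
  move=> zB; apply: lt_trans (Lbeta j z zB).
  by rewrite divr_gt0 // subr_gt0.
split=> [[m Hm]|[p [c [c0 Hpc]]]].
  exists m, (m.+1)`!%:R; split=> // z zB.
  by apply: bounded_Lindex_max_dquot => [j|J]; [exact: L0|exact: Hm].
pose rho := beta / Num.sqrt n%:R.
have rho1 : 1 < rho by rewrite ltr_pdivlMr // mul1r.
have rho0 : 0 < rho := lt_trans ltr01 rho1.
have bE : beta = rho * Num.sqrt n%:R by rewrite divfK // gt_eqF.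
have rb : enorm (fun _ : 'I_n => rho) <= beta.
  rewrite /enorm sumr_const card_ord -[_ *+ n]mulr_natr sqrtrM ?sqr_ge0 //.
  by rewrite sqrtr_sqr gtr0_norm // -bE.
have [q [q1 Lq]] := classQ_bounded_ratio LQ L0 (fun=> ltW rho0) rb.
apply: (max_dquot_bounded_Lindex F_analytic c0 q1 rho1 Lq L0 _ Hpc) => z0 z0B.
exact: (polydisc_sub_ball n_gt0 rho0 bE z0B (fun j => Lbeta j z0 z0B)).
Qed.
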